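(* Let $m<n$, $k\ge 1$ and $\omega\ge 1$ be integers with $n>3k$, and put $\sigma:=\lceil\frac{n-2k}{k}\rceil$. Let $A\in\mathbb{R}^{m\times n}$ have restricted isometry constants $\delta_t$, and let $x\in\mathbb{R}^n$, $y,\nu\in\mathbb{R}^m$ satisfy $y=Ax+\nu$. Let $S:=\mathcal{L}_k(x)$, $\overline S:=\{1,\dots,n\}\setminus S$, $\nu':=\nu+Ax_{\overline S}$. Denote $$t_k:=\frac{\sqrt{1+\delta_k}}{\sqrt{1-\delta_{2k}}},\qquad z_k:=\sqrt{1-\delta_{2k}^2},\qquad G_\omega(\gamma):=(2\omega+1)\gamma\sqrt{\frac{1+\gamma}{1-\gamma}}+\gamma,$$ $$d_0:=t_k(\omega\xi_\sigma+1),\quad d_1:=t_k(2\omega\delta_{3k}+\delta_{2k})+\delta_{3k},\quad d_2:=t_k[\xi_\sigma(\omega-1)+1]\frac{2\omega\delta_{3k}+\delta_{2k}}{2(\omega-1)\delta_{3k}+\delta_{2k}},$$ $$c_{1,\sigma}:=\big(\xi_\sigma(\omega-1)+1\big)|1-\alpha+\beta|+\alpha\big(2(\omega-1)\delta_{3k}+\delta_{2k}\big),$$ $$c_\sigma:=(\omega\xi_\sigma+1)|1-\alpha+\beta|+\alpha(2\omega\delta_{3k}+\delta_{2k}),$$ $$b_1:=t_kc_\sigma+|1+\beta-\alpha|+\alpha\delta_{3k},\qquad b_2:=\beta t_k[\xi_\sigma(\omega-1)+1]\frac{c_\sigma}{c_{1,\sigma}}+\beta,$$ $$b_3:=\frac{\alpha(2\omega-1)(1+\delta_k)+2}{\sqrt{1-\delta_{2k}}}\cdot\frac{2\delta_{3k}}{2(\omega-1)\delta_{3k}+\delta_{2k}}\cdot\frac{c_\sigma}{c_\sigma-c_{1,\sigma}}+\alpha\sqrt{1+\delta_k}.$$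 (i) Let $\gamma^*(\omega)$ be the unique root of $G_\omega(\gamma)=1$ in $(0,1)$. Assume $\delta_{3k}<\gamma^*(\omega)$ and that the nonnegative parameters $\alpha,\beta$ satisfy $$\beta<\frac{1-d_1}{1+d_1+d_2},\qquad \frac{(d_0+d_2+2)\beta+d_0}{d_0-d_1+1}<\alpha<\frac{d_0+2-(d_2-d_0)\beta}{d_0+d_1+1}.$$ Let $\theta_1:=\frac{b_1+\sqrt{b_1^2+4b_2}}{2}$. Then $\theta_1<1$, and every sequence $\{x^p\}$ produced by HBROT$\omega$ with input $(A,y,k)$ and $k$-sparse initial points $x^0,x^1$ satisfies, for all $p\ge1$, $$\|x^p-x_S\|_2\leq\theta_1^{p-1}\left[\|x^1-x_S\|_2+(\theta_1-b_1)\|x^0-x_S\|_2\right]+\frac{b_3}{1-\theta_1}\|\nu'\|_2.$$ (ii) Let $\gamma^\sharp(\omega)$ be the unique root of $\frac{1}{\sqrt{1-\gamma^2}}G_\omega(\gamma)=1$ in $(0,1)$. Assume $\delta_{3k}<\gamma^\sharp(\omega)$ and that the nonnegative parameters $\alpha,\beta$ satisfy $$\beta<\frac{z_k-d_1}{1+d_1+d_2},\qquad \frac{(d_0+d_2+2)\beta+d_0+1-z_k}{d_0-d_1+1}<\alpha<\frac{d_0+1+z_k-(d_2-d_0)\beta}{d_0+d_1+1}.$$ Let $\theta_2:=\frac{b_1+\sqrt{b_1^2+4b_2z_k}}{2z_k}$. Then $\theta_2<1$, and every sequence $\{x^p\}$ produced by HBROTP$\omega$ with input $(A,y,k)$ and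 $k$-sparse initial points $x^0,x^1$ satisfies, for all $p\ge 1$, $$\|x^p-x_S\|_2\leq\theta_2^{p-1}\left[\|x^1-x_S\|_2+\Big(\theta_2-\frac{b_1}{z_k}\Big)\|x^0-x_S\|_2\right]+\frac{1}{1-\theta_2}\left(\frac{b_3}{z_k}+\frac{\sqrt{1+\delta_k}}{1-\delta_{2k}}\right)\|\nu'\|_2.$$
   Context: Notation. A vector is $k$-sparse if it has at most $k$ nonzero entries. For $z\in\mathbb{R}^n$ and $\Omega\subseteq\{1,\dots,n\}$, $z_\Omega\in\mathbb{R}^n$ is the vector that agrees with $z$ on $\Omega$ and is zero off $\Omega$; $\mathrm{supp}(z)=\{i:z_i\neq0\}$; $\mathcal{L}_k(z)$ is the index set of the $k$ largest entries of $z$ in absolute value (ties broken in some fixed way); $\mathcal{H}_k(z):=z_{\mathcal{L}_k(z)}$ (hard thresholding). $u\circ v$ is the entrywise (Hadamard) product; $\mathbf{e}$ is the all-ones vector. Constants $\xi_q$ for integers $q\ge1$: $\xi_1=1$; $\xi_q=\frac{2}{\sqrt q}+\frac{\sqrt q}{4}$ for $2\le q<8$; $\xi_q=\sqrt2$ for $q\ge 8$. Restricted isometry constant (RIC). For $A\in\mathbb{R}^{m\times n}$ with $m<n$, $\delta_t$ is the smallest number $\delta\ge 0$ such that $(1-\delta)\|u\|_2^2\le\|Au\|_2^2\le(1+\delta)\|u\|_2^2$ for all $t$-sparse $u\in\mathbb{R}^n$. Algorithms HBROT$\omega$ and HBROTP$\omega$. Input: $(A,y,k)$, initial points $x^0,x^1\in\mathbb{R}^n$,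 integer $\omega\ge1$, parameters $\alpha>0$, $\beta\ge0$. For $p=1,2,\dots$: (S1) $u^p=x^p-\alpha A^T(Ax^p-y)+\beta(x^p-x^{p-1})$. (S2) Set $v\leftarrow u^p$. For $j=1,\dots,\omega$: let $w^{(j)}$ be a minimizer of $\|y-A(v\circ w)\|_2^2$ over all $w\in\mathbb{R}^n$ with $\mathbf{e}^Tw=k$, $0\le w\le\mathbf{e}$; then set $v\leftarrow v\circ w^{(j)}$. (S3) Let $x^\sharp=\mathcal{H}_k(u^p\circ w^{(1)}\circ\cdots\circ w^{(\omega)})$. For HBROT$\omega$: $x^{p+1}=x^\sharp$. For HBROTP$\omega$: let $S^{p+1}=\mathrm{supp}(x^\sharp)$ and let $x^{p+1}$ be a minimizer of $\|y-Ax\|_2^2$ over all $x\in\mathbb{R}^n$ with $\mathrm{supp}(x)\subseteq S^{p+1}$. *)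

(* Defs.v *)
From HB Require Import structures.
From mathcomp Require Import all_boot all_order all_algebra.
From mathcomp Require Import boolp classical_sets reals.

Set Implicit Arguments.
Unset Strict Implicit.
Unset Printing Implicit Defensive.

Import Order.TTheory GRing.Theory Num.Theory.

Local Open Scope ring_scope.

(* The norm that MathComp-Analysis puts on matrices is the sup norm, hence an
   explicit Euclidean norm. *)
Definition l2norm (R : realType) (n : nat) (v : 'cV[R]_n) : R :=
  Num.sqrt (\sum_(i < n) v i 0 ^+ 2).

Definition supp (R : realType) (n : nat) (v : 'cV[R]_n) : {set 'I_n} :=
  [set i | v i 0 != 0].

Definition sparse (R : realType) (n : nat) (k : nat) (v : 'cV[R]_n) : bool :=
  (#|supp v| <= k)%N.

Definition restr (R : realType) (n : nat) (Om : {set 'I_n}) (v : 'cV[R]_n) :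
  'cV[R]_n := \col_i (if i \in Om then v i 0 else 0).

Definition hadamard (R : realType) (n : nat) (u v : 'cV[R]_n) : 'cV[R]_n :=
  map2_mx *%R u v.

(* [L] is a k-largest-entries map z |-> L_k(z); being a function of z, it
   embodies one fixed (but arbitrary) tie-breaking rule. *)
Definition largest_selector (R : realType) (n k : nat)
    (L : 'cV[R]_n -> {set 'I_n}) : Prop :=
  forall z, #|L z| = k /\
    (forall i j, i \in L z -> j \notin L z -> `|z j 0| <= `|z i 0|).

Definition hard_thr (R : realType) (n : nat) (L : 'cV[R]_n -> {set 'I_n})
    (z : 'cV[R]_n) : 'cV[R]_n := restr (L z) z.

Definition ric_bound (R : realType) (m n : nat) (A : 'M[R]_(m, n)) (t : nat)
    (d : R) : Prop :=
  0 <= d /\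
  forall u : 'cV[R]_n, sparse t u ->
    (1 - d) * l2norm u ^+ 2 <= l2norm (A *m u) ^+ 2 <=
    (1 + d) * l2norm u ^+ 2.

(* The infimum is attained, see [ricP]. *)
Definition ric (R : realType) (m n : nat) (A : 'M[R]_(m, n)) (t : nat) : R :=
  inf [set d : R | ric_bound A t d]%classic.

Lemma l2norm_sqr (R : realType) (n : nat) (v : 'cV[R]_n) :
  l2norm v ^+ 2 = \sum_(i < n) v i 0 ^+ 2.
Proof. by rewrite sqr_sqrtr //; apply: sumr_ge0 => i _; exact: sqr_ge0. Qed.

Lemma ric_bound_ex (R : realType) (m n : nat) (A : 'M[R]_(m, n)) (t : nat) :
  exists d, ric_bound A t d.
Proof.
pose C := \sum_(i < m) (\sum_(j < n) `|A i j|) ^+ 2.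
have C0 : 0 <= C by apply: sumr_ge0 => i _; exact: sqr_ge0.
exists (1 + C); split; first by rewrite addr_ge0.
move=> u _; apply/andP; split.
  rewrite opprD addrA subrr add0r mulNr.
  apply: (@le_trans _ _ 0); last exact: sqr_ge0.
  by rewrite oppr_le0 mulr_ge0 // sqr_ge0.
apply: (@le_trans _ _ (C * l2norm u ^+ 2)); last first.
  by rewrite ler_wpM2r ?sqr_ge0 // addrA lerDr addr_ge0.
rewrite l2norm_sqr /C mulr_suml; apply: ler_sum => i _.
rewrite -exprMn -real_normK ?num_real // lerXn2r //.
- by rewrite nnegrE normr_ge0.
- by rewrite nnegrE mulr_ge0 ?sqrtr_ge0 // sumr_ge0.
rewrite mxE mulr_suml; apply: (le_trans (ler_norm_sum _ _ _)).
apply: ler_sum => j _; rewrite normrM; apply: ler_wpM2l => //.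
rewrite -sqrtr_sqr; apply: ler_wsqrtr.
rewrite (bigD1 j) //= lerDl; apply: sumr_ge0 => l _; exact: sqr_ge0.
Qed.

Lemma ricP (R : realType) (m n : nat) (A : 'M[R]_(m, n)) (t : nat) :
  ric_bound A t (ric A t) /\ forall d, ric_bound A t d -> ric A t <= d.
Proof.
have ne : ([set d : R | ric_bound A t d] !=set0)%classic.
  by have [d hd] := ric_bound_ex A t; exists d.
have lb : has_lbound [set d : R | ric_bound A t d]%classic.
  by exists 0 => d [].
split; last by move=> d hd; exact: (ge_inf lb).
split; first by apply: lb_le_inf => // d [].
move=> u su; have := sqr_ge0 (l2norm u); rewrite le0r => /predU1P[u0|u0].
  have [d [_ /(_ u su)]] := ric_bound_ex A t.
  by rewrite u0 !mulr0.
apply/andP; split.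
- rewrite -ler_pdivlMr // lerBlDr -lerBlDl; apply: lb_le_inf => // d [_ /(_ u su)].
  by rewrite lerBlDl -lerBlDr ler_pdivlMr // => /andP[].
- rewrite -ler_pdivrMr // -lerBlDl; apply: lb_le_inf => // d [_ /(_ u su)].
  by rewrite lerBlDl ler_pdivrMr // => /andP[].
Qed.

(* Meant for q >= 1. *)
Definition xi (R : realType) (q : nat) : R :=
  if (q <= 1)%N then 1
  else if (q < 8)%N then 2 / Num.sqrt q%:R + Num.sqrt q%:R / 4
  else Num.sqrt 2.

(* The ceiling is nonnegative when 2 * k <= n, the case of interest. *)
Definition sigma_nk (n k : nat) : nat :=
  `|Num.ceil ((n%:R - 2 * k%:R) / k%:R : rat)|%N.

Definition G (R : realType) (omega : nat) (gamma : R) : R :=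
  (2 * omega%:R + 1) * gamma * Num.sqrt ((1 + gamma) / (1 - gamma)) + gamma.

Definition is_minimizer (R : realType) (T : Type) (D : T -> Prop) (f : T -> R)
    (z : T) : Prop :=
  D z /\ forall z', D z' -> f z <= f z'.

Definition in_polytope (R : realType) (n k : nat) (w : 'cV[R]_n) : Prop :=
  \sum_(i < n) w i 0 = k%:R /\ forall i, 0 <= w i 0 <= 1.

(* u o w_1 o ... o w_j; the values of [w] used have index 1, ..., j. *)
Fixpoint hadamard_upto (R : realType) (n : nat) (u : 'cV[R]_n)
    (w : nat -> 'cV[R]_n) (j : nat) : 'cV[R]_n :=
  if j is i.+1 then hadamard (hadamard_upto u w i) (w i.+1) else u.

Definition gradient_step (R : realType) (m n : nat) (A : 'M[R]_(m, n))
    (y : 'cV[R]_m) (alpha beta : R) (xprev xcur : 'cV[R]_n) : 'cV[R]_n :=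
  xcur - alpha *: (A^T *m (A *m xcur - y)) + beta *: (xcur - xprev).

(* [xsharp] is a possible outcome of one round (relaxed optimal thresholding
   [omega] times, then hard thresholding) started from the two last iterates.
   It is a relation since the minimizers need not be unique. *)
Definition rot_step (R : realType) (m n : nat) (A : 'M[R]_(m, n))
    (y : 'cV[R]_m) (k omega : nat) (L : 'cV[R]_n -> {set 'I_n})
    (alpha beta : R) (xprev xcur xsharp : 'cV[R]_n) : Prop :=
  let u := gradient_step A y alpha beta xprev xcur in
  exists w : nat -> 'cV[R]_n,
    (forall j, (1 <= j <= omega)%N ->
       is_minimizer (@in_polytope R n k)
         (fun w' => l2norm (y - A *m hadamard (hadamard_upto u w j.-1) w') ^+ 2)
         (w j)) /\
    xsharp = hard_thr L (hadamard_upto u w omega).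

Definition HBROT (R : realType) (m n : nat) (A : 'M[R]_(m, n))
    (y : 'cV[R]_m) (k omega : nat) (L : 'cV[R]_n -> {set 'I_n})
    (alpha beta : R) (xs : nat -> 'cV[R]_n) : Prop :=
  forall p, (1 <= p)%N ->
    rot_step A y k omega L alpha beta (xs p.-1) (xs p) (xs p.+1).

Definition HBROTP (R : realType) (m n : nat) (A : 'M[R]_(m, n))
    (y : 'cV[R]_m) (k omega : nat) (L : 'cV[R]_n -> {set 'I_n})
    (alpha beta : R) (xs : nat -> 'cV[R]_n) : Prop :=
  forall p, (1 <= p)%N ->
    exists2 xsharp : 'cV[R]_n,
      rot_step A y k omega L alpha beta (xs p.-1) (xs p) xsharp &
      is_minimizer (fun z : 'cV[R]_n => supp z \subset supp xsharp)
        (fun z => l2norm (y - A *m z) ^+ 2) (xs p.+1).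

(* Main.v *)
Require Import Defs.
From HB Require Import structures.
From mathcomp Require Import all_boot all_order all_algebra.
From mathcomp Require Import boolp classical_sets reals.
From mathcomp Require Import ring lra.

(* Write u - x_S = (1 - alpha + beta) d + alpha (I - A^T A) d - beta e
   + alpha A^T nu' with d, e the errors of the last two iterates. Comparing each
   minimizer w^(j) with the indicator of S shows that one more thresholding
   raises the residual |y - A v_j| by at most |A (v_j)_{S^c}|. Such a tail is
   cut into blocks of k indices by decreasing weight w^(1) o ... o w^(j): as the
   weights lie in [0, 1] and sum to at most k, the block maxima h_i satisfy
   sum h_i <= 2, hence also sum h_i^2 <= 2, and the restricted isometry property
   on each block bounds the tail with constants sqrt 2 <= xi_sigma and 2. This
   gives |x^(p+1) - x_S| <= b_1 |d| + b_2 |e| + b_3 |nu'| for HBROT; the least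
   squares step of HBROTP divides the coefficients by z_k and adds a multiple of
   |nu'|. The bounds on alpha and beta imply b_1 + b_2 < 1 (resp. < z_k), so that
   the larger root theta of t^2 = b_1 t + b_2 (resp. t^2 = (b_1 t + b_2) / z_k)
   is a contraction factor. *)

Set Implicit Arguments.
Unset Strict Implicit.
Unset Printing Implicit Defensive.

Import Order.TTheory GRing.Theory Num.Theory.
Local Open Scope ring_scope.

(** * Inner product, Euclidean norm and restriction to index sets *)

Definition dot (R : realType) (n : nat) (u v : 'cV[R]_n) : R :=
  \sum_(i < n) u i 0 * v i 0.

Lemma ler_sqr_nneg (R : realType) (a b : R) :
  0 <= b -> a ^+ 2 <= b ^+ 2 -> a <= b.
Proof.
move=> b0 h; apply: (le_trans (ler_norm a)).
by rewrite -ler_sqr ?nnegrE // real_normK ?num_real.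
Qed.

(** Induction whose step is the two-dimensional case for [(F i, p)] and [(H i, q)], the gap being
    the square of [F i * q - p * H i]. Lists are used because the inequality serves both for
    coordinates and for sums over blocks. *)
Lemma cauchy_schwarz_seq (R : realType) (I : Type) (s : seq I) (F H : I -> R) :
  \sum_(i <- s) F i * H i <=
  Num.sqrt (\sum_(i <- s) F i ^+ 2) * Num.sqrt (\sum_(i <- s) H i ^+ 2).
Proof.
elim: s => [|i s IH]; first by rewrite !big_nil sqrtr0 mul0r.
rewrite !big_cons.
set P := \sum_(j <- s) F j ^+ 2; set Q := \sum_(j <- s) H j ^+ 2.
have P0 : 0 <= P by apply: sumr_ge0 => j _; exact: sqr_ge0.
have Q0 : 0 <= Q by apply: sumr_ge0 => j _; exact: sqr_ge0.
have p0 := sqrtr_ge0 P; have q0 := sqrtr_ge0 Q.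
apply: (le_trans (lerD (lexx _) IH)); rewrite -/P -/Q.
rewrite -{2}(sqr_sqrtr P0) -{2}(sqr_sqrtr Q0).
move: (Num.sqrt P) (Num.sqrt Q) p0 q0 => p q p0 q0.
apply: ler_sqr_nneg; first by rewrite mulr_ge0 ?sqrtr_ge0.
rewrite exprMn !sqr_sqrtr ?addr_ge0 ?sqr_ge0 //.
rewrite -subr_ge0.
have -> : (F i ^+ 2 + p ^+ 2) * (H i ^+ 2 + q ^+ 2) - (F i * H i + p * q) ^+ 2
  = (F i * q - p * H i) ^+ 2 by ring.
exact: sqr_ge0.
Qed.

Lemma l2norm_ge0 (R : realType) (n : nat) (v : 'cV[R]_n) : 0 <= l2norm v.
Proof. exact: sqrtr_ge0. Qed.

Lemma l2norm_dot (R : realType) (n : nat) (v : 'cV[R]_n) : l2norm v ^+ 2 = dot v v.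
Proof. by rewrite l2norm_sqr; apply: eq_bigr => i _; rewrite expr2. Qed.

Lemma dot_le (R : realType) (n : nat) (u v : 'cV[R]_n) :
  dot u v <= l2norm u * l2norm v.
Proof. exact: cauchy_schwarz_seq. Qed.

Lemma dotC (R : realType) (n : nat) (u v : 'cV[R]_n) : dot u v = dot v u.
Proof. by apply: eq_bigr => i _; rewrite mulrC. Qed.

Lemma dotDr (R : realType) (n : nat) (u v w : 'cV[R]_n) :
  dot u (v + w) = dot u v + dot u w.
Proof. by rewrite -big_split; apply: eq_bigr => i _; rewrite mxE mulrDr. Qed.

Lemma dotZr (R : realType) (n : nat) (a : R) (u v : 'cV[R]_n) :
  dot u (a *: v) = a * dot u v.
Proof. by rewrite mulr_sumr; apply: eq_bigr => i _; rewrite mxE mulrCA. Qed.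

Lemma dotNr (R : realType) (n : nat) (u v : 'cV[R]_n) : dot u (- v) = - dot u v.
Proof. by rewrite -scaleN1r dotZr mulN1r. Qed.

Lemma dotDl (R : realType) (n : nat) (u v w : 'cV[R]_n) :
  dot (u + v) w = dot u w + dot v w.
Proof. by rewrite dotC dotDr !(dotC w). Qed.

Lemma dotZl (R : realType) (n : nat) (a : R) (u v : 'cV[R]_n) :
  dot (a *: u) v = a * dot u v.
Proof. by rewrite dotC dotZr dotC. Qed.

Lemma dotNl (R : realType) (n : nat) (u v : 'cV[R]_n) : dot (- u) v = - dot u v.
Proof. by rewrite dotC dotNr dotC. Qed.

Lemma dot_trmx (R : realType) (m n : nat) (A : 'M[R]_(m, n)) (u : 'cV[R]_n)
    (v : 'cV[R]_m) : dot u (A^T *m v) = dot (A *m u) v.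
Proof.
have dotE p (a b : 'cV[R]_p) : dot a b = (a^T *m b) 0 0.
  by rewrite mxE; apply: eq_bigr => i _; rewrite mxE.
by rewrite !dotE trmx_mul mulmxA.
Qed.

Lemma l2normD (R : realType) (n : nat) (u v : 'cV[R]_n) :
  l2norm (u + v) <= l2norm u + l2norm v.
Proof.
have u0 := l2norm_ge0 u; have v0 := l2norm_ge0 v.
apply: ler_sqr_nneg; first exact: addr_ge0.
rewrite sqrrD !l2norm_dot dotDl !dotDr (dotC v u).
by have := dot_le u v; lra.
Qed.

Lemma l2normZ (R : realType) (n : nat) (a : R) (u : 'cV[R]_n) :
  l2norm (a *: u) = `|a| * l2norm u.
Proof.
apply/eqP; rewrite -(@eqrXn2 _ 2) ?mulr_ge0 ?l2norm_ge0 //.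
by rewrite exprMn !l2norm_dot dotZl dotZr real_normK ?num_real // mulrA -expr2.
Qed.

Lemma l2normN (R : realType) (n : nat) (u : 'cV[R]_n) : l2norm (- u) = l2norm u.
Proof. by rewrite -scaleN1r l2normZ normrN1 mul1r. Qed.

Lemma l2norm0 (R : realType) (n : nat) : l2norm (0 : 'cV[R]_n) = 0.
Proof. by rewrite -(scale0r (0 : 'cV[R]_n)) l2normZ normr0 mul0r. Qed.

Lemma l2normB_sqr (R : realType) (n : nat) (u v : 'cV[R]_n) :
  l2norm (u - v) ^+ 2 = l2norm u ^+ 2 - 2 * dot u v + l2norm v ^+ 2.
Proof.
by rewrite !l2norm_dot dotDl !dotDr !dotNl !dotNr (dotC v u); ring.
Qed.

Lemma l2normBC (R : realType) (n : nat) (u v : 'cV[R]_n) :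
  l2norm (u - v) = l2norm (v - u).
Proof. by rewrite -l2normN opprB. Qed.

Lemma l2norm_sum (R : realType) (n : nat) (I : Type) (s : seq I)
    (F : I -> 'cV[R]_n) :
  l2norm (\sum_(i <- s) F i) <= \sum_(i <- s) l2norm (F i).
Proof.
elim: s => [|i s IH]; first by rewrite !big_nil l2norm0.
by rewrite !big_cons (le_trans (l2normD _ _)) // lerD2l.
Qed.

Lemma l2norm_le (R : realType) (n : nat) (u v : 'cV[R]_n) :
  (forall i, `|u i 0| <= `|v i 0|) -> l2norm u <= l2norm v.
Proof.
move=> h; apply: ler_wsqrtr; apply: ler_sum => i _.
by rewrite -(real_normK (num_real (u i 0))) -(real_normK (num_real (v i 0)))
  ler_sqr ?nnegrE.
Qed.

Lemma restrD (R : realType) (n : nat) (Q : {set 'I_n}) (u v : 'cV[R]_n) :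
  restr Q (u + v) = restr Q u + restr Q v.
Proof. by apply/matrixP => i j; rewrite !mxE; case: ifP; rewrite ?addr0. Qed.

Lemma restrZ (R : realType) (n : nat) (Q : {set 'I_n}) (a : R) (u : 'cV[R]_n) :
  restr Q (a *: u) = a *: restr Q u.
Proof. by apply/matrixP => i j; rewrite !mxE; case: ifP; rewrite ?mulr0. Qed.

Lemma restrN (R : realType) (n : nat) (Q : {set 'I_n}) (u : 'cV[R]_n) :
  restr Q (- u) = - restr Q u.
Proof. by rewrite -scaleN1r restrZ scaleN1r. Qed.

Lemma restr_setC (R : realType) (n : nat) (Q : {set 'I_n}) (u : 'cV[R]_n) :
  restr Q u + restr (~: Q) u = u.
Proof.
apply/matrixP => i j; rewrite ord1 !mxE inE.
by case: (i \in Q); rewrite ?addr0 ?add0r.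
Qed.

Lemma supp_restr (R : realType) (n : nat) (Q : {set 'I_n}) (u : 'cV[R]_n) :
  supp (restr Q u) \subset Q.
Proof. by apply/fintype.subsetP => i; rewrite inE mxE; case: ifP; rewrite ?eqxx. Qed.

Lemma restr_id (R : realType) (n : nat) (Q : {set 'I_n}) (u : 'cV[R]_n) :
  supp u \subset Q -> restr Q u = u.
Proof.
move=> /fintype.subsetP h; apply/matrixP => i j; rewrite ord1 mxE.
case: ifPn => // /(contra (h i)); rewrite inE negbK => /eqP //.
Qed.

Lemma l2norm_restr (R : realType) (n : nat) (Q : {set 'I_n}) (u : 'cV[R]_n) :
  l2norm (restr Q u) <= l2norm u.
Proof. by apply: l2norm_le => i; rewrite mxE; case: ifP; rewrite ?normr0. Qed.

Lemma dot_restr (R : realType) (n : nat) (Q : {set 'I_n}) (u v : 'cV[R]_n) :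
  dot (restr Q u) (restr Q v) = dot (restr Q u) v.
Proof.
by apply: eq_bigr => i _; rewrite !mxE; case: ifP; rewrite ?mul0r.
Qed.

Lemma suppD (R : realType) (n : nat) (u v : 'cV[R]_n) :
  supp (u + v) \subset supp u :|: supp v.
Proof.
apply/fintype.subsetP => i; rewrite !inE mxE; apply: contraR; rewrite negb_or !negbK.
by move=> /andP[/eqP -> /eqP ->]; rewrite addr0.
Qed.

Lemma suppZ (R : realType) (n : nat) (a : R) (u : 'cV[R]_n) :
  supp (a *: u) \subset supp u.
Proof.
apply/fintype.subsetP => i; rewrite !inE mxE; apply: contraNN => /eqP ->.
by rewrite mulr0.
Qed.

Lemma suppN (R : realType) (n : nat) (u : 'cV[R]_n) : supp (- u) = supp u.
Proof. by apply/setP => i; rewrite !inE mxE oppr_eq0. Qed.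

Lemma suppB (R : realType) (n : nat) (u v : 'cV[R]_n) :
  supp (u - v) \subset supp u :|: supp v.
Proof. by rewrite -(suppN v) suppD. Qed.

Lemma sparse_le (R : realType) (n k : nat) (Q : {set 'I_n}) (u : 'cV[R]_n) :
  supp u \subset Q -> (#|Q| <= k)%N -> sparse k u.
Proof. by move=> h1 h2; apply: leq_trans h2; exact: subset_leq_card. Qed.

(** * Restricted isometry *)

Lemma ric_ge0 (R : realType) (m n t : nat) (A : 'M[R]_(m, n)) : 0 <= ric A t.
Proof. by case: (ricP A t) => -[]. Qed.

Lemma ric_le (R : realType) (m n s t : nat) (A : 'M[R]_(m, n)) :
  (s <= t)%N -> ric A s <= ric A t.
Proof.
move=> st; have [_ min_s] := ricP A s; have [[d0 bd] _] := ricP A t.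
apply: min_s; split=> // u su; apply: bd; exact: leq_trans su st.
Qed.

Lemma ric_upper (R : realType) (m n t : nat) (A : 'M[R]_(m, n)) (u : 'cV[R]_n) :
  sparse t u -> l2norm (A *m u) <= Num.sqrt (1 + ric A t) * l2norm u.
Proof.
have [[d0 bd] _] := ricP A t => /bd/andP[_ h].
apply: ler_sqr_nneg; first by rewrite mulr_ge0 ?sqrtr_ge0 ?l2norm_ge0.
rewrite exprMn [X in X * _]sqr_sqrtr; first exact: h.
by rewrite addr_ge0.
Qed.

Lemma ric_lower (R : realType) (m n t : nat) (A : 'M[R]_(m, n)) (u : 'cV[R]_n) :
  ric A t <= 1 -> sparse t u ->
  Num.sqrt (1 - ric A t) * l2norm u <= l2norm (A *m u).
Proof.
have [[d0 bd] _] := ricP A t => d1 /bd/andP[h _].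
apply: ler_sqr_nneg; first exact: l2norm_ge0.
rewrite exprMn [X in X * _]sqr_sqrtr; first exact: h.
by rewrite subr_ge0.
Qed.

(** Polarization: after scaling to equal lengths, the lower isometry bound on the sum and the upper
    one on the difference isolate the inner product. The one-sided form suffices, since [u] can be
    replaced by [- u]. *)
Lemma ric_dot (R : realType) (m n t : nat) (A : 'M[R]_(m, n)) (Q : {set 'I_n})
    (u v : 'cV[R]_n) :
  supp u \subset Q -> supp v \subset Q -> (#|Q| <= t)%N ->
  dot u (v - A^T *m (A *m v)) <= ric A t * (l2norm u * l2norm v).
Proof.
move=> uQ vQ Qt; have [[d0 bd] _] := ricP A t; set d := ric A t in d0 bd *.
(* The scaling argument cancels both norms, so vectors of norm 0 are treated apart. *)
have [/eqP|u0] := eqVneq (l2norm u) 0.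
  rewrite -sqrf_eq0 => /eqP u0; have := dot_le u (v - A^T *m (A *m v)).
  by move/eqP: u0; rewrite sqrf_eq0 => /eqP ->; rewrite !mul0r mulr0.
have [/eqP|v0] := eqVneq (l2norm v) 0.
  have := ric_upper A (sparse_le vQ Qt).
  have := dot_le u (v - A^T *m (A *m v)).
  rewrite dotDr dotNr dot_trmx => _ h /eqP v0.
  have := dot_le u v; have := dot_le (- (A *m u)) (A *m v).
  rewrite dotNl l2normN.
  move: h; rewrite v0 !mulr0 => h.
  have -> : l2norm (A *m v) = 0 by apply/eqP; rewrite eq_le h l2norm_ge0.
  by rewrite mulr0; lra.
set a := l2norm u in u0 *; set b := l2norm v in v0 *.
have a0 : 0 < a by rewrite lt_def u0 l2norm_ge0.
have b0 : 0 < b by rewrite lt_def v0 l2norm_ge0.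
(* Both summands have length [a * b], so the squared lengths of [s] and [r] differ by
   [4 * a * b * dot u v]. *)
pose s := b *: u + a *: v; pose r := b *: u - a *: v.
have sQ : supp s \subset Q.
  apply: (fintype.subset_trans (suppD _ _)); rewrite finset.subUset.
  by rewrite (fintype.subset_trans (suppZ _ _) uQ) (fintype.subset_trans (suppZ _ _) vQ).
have rQ : supp r \subset Q.
  apply: (fintype.subset_trans (suppB _ _)); rewrite finset.subUset.
  by rewrite (fintype.subset_trans (suppZ _ _) uQ) (fintype.subset_trans (suppZ _ _) vQ).
have /andP[s1 _] := bd s (sparse_le sQ Qt).
have /andP[_ r1] := bd r (sparse_le rQ Qt).
rewrite dotDr dotNr dot_trmx -(ler_pM2l (mulr_gt0 a0 b0)).
move: s1 r1; rewrite !l2norm_dot /s /r mulmxDr mulmxBr -!scalemxAr.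
rewrite !(dotDl, dotDr, dotZr, dotZl, dotNr, dotNl).
rewrite !(dotC v u) !(dotC (A *m v) (A *m u)) -!l2norm_dot -/a -/b.
move: (dot u v) (dot (A *m u) (A *m v)) (l2norm (A *m u)) (l2norm (A *m v)).
move=> X Y p q; nra.
Qed.

(** Duality: the restricted residual is its own test vector in [ric_dot], and one factor of its norm
    is cancelled. *)
Lemma l2norm_restr_residual (R : realType) (m n t : nat) (A : 'M[R]_(m, n))
    (P Q : {set 'I_n}) (v : 'cV[R]_n) :
  supp v \subset Q -> (#|P :|: Q| <= t)%N ->
  l2norm (restr P (v - A^T *m (A *m v))) <= ric A t * l2norm v.
Proof.
move=> vQ PQt; set g := restr P _.
have := @ric_dot _ _ _ t A (P :|: Q) g v
  (fintype.subset_trans (supp_restr _ _) (finset.subsetUl _ _))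
  (fintype.subset_trans vQ (finset.subsetUr _ _)) PQt.
rewrite -dot_restr -/g -l2norm_dot mulrCA expr2.
have [->|g0] := eqVneq (l2norm g) 0.
  by rewrite mulr_ge0 ?ric_ge0 ?l2norm_ge0.
by rewrite ler_pM2l // lt_def g0 l2norm_ge0.
Qed.

(** Duality again: the squared norm of the restriction [g] is [dot (A *m g) v], and [A *m g] obeys
    the upper isometry bound. *)
Lemma l2norm_restr_trmx (R : realType) (m n t : nat) (A : 'M[R]_(m, n))
    (P : {set 'I_n}) (v : 'cV[R]_m) :
  (#|P| <= t)%N ->
  l2norm (restr P (A^T *m v)) <= Num.sqrt (1 + ric A t) * l2norm v.
Proof.
move=> Pt; set g := restr P _.
have := dot_le (A *m g) v; rewrite -dot_trmx -dot_restr -/g -l2norm_dot.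
have := @ric_upper _ _ _ t A g (sparse_le (supp_restr _ _) Pt).
have := l2norm_ge0 g; have := l2norm_ge0 v; have := sqrtr_ge0 (1 + ric A t).
move: (l2norm g) (l2norm v) (l2norm (A *m g)) (Num.sqrt _) => a b c s s0 b0 a0 h1 h2.
have h3 : a ^+ 2 <= s * a * b by apply: (le_trans h2); rewrite ler_wpM2r.
have [->|an0] := eqVneq a 0; first exact: mulr_ge0.
have ap : 0 < a by rewrite lt_def an0.
by rewrite -(ler_pM2l ap); move: h3; rewrite expr2 mulrCA mulrA.
Qed.

(** A zero constant would force [A^T *m A = 1%:M], by [ric_dot] on pairs of basis vectors, against
    [m < n]. Positivity is wanted for the denominator [2 * (w - 1) * d3k + d2k], which is just [d2k]
    when [omega] is 1. *)
Lemma ric_gt0 (R : realType) (m n t : nat) (A : 'M[R]_(m, n)) :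
  (m < n)%N -> (2 <= t)%N -> 0 < ric A t.
Proof.
move=> mn t2; rewrite lt_def ric_ge0 andbT; apply/eqP => d0.
suff AA : A^T *m A = 1%:M by have := mulmx1_min AA; rewrite leqNgt mn.
have supp_e (i : 'I_n) : supp (delta_mx i 0 : 'cV[R]_n) \subset [set i].
  by apply/fintype.subsetP => j; rewrite !inE mxE andbT; case: (j == i); rewrite ?eqxx.
have dot_e (i : 'I_n) (v : 'cV[R]_n) : dot (delta_mx i 0) v = v i 0.
  rewrite /dot (bigD1 i) //= big1 => [|j ji]; rewrite !mxE.
    by rewrite eqxx mul1r addr0.
  by rewrite (negPf ji) mul0r.
apply/matrixP => i j.
have card2 : (#|[set i; j]| <= t)%N.
  by rewrite cards2; apply: leq_trans t2; case: (i != j).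
have ei : supp (delta_mx i 0 : 'cV[R]_n) \subset [set i; j].
  by apply: (fintype.subset_trans (supp_e i)); apply: finset.subsetUl.
have ej : supp (delta_mx j 0 : 'cV[R]_n) \subset [set i; j].
  by apply: (fintype.subset_trans (supp_e j)); apply: finset.subsetUr.
have Nei : supp (- delta_mx i 0 : 'cV[R]_n) \subset [set i; j] by rewrite suppN.
have h1 := @ric_dot _ _ _ t A _ _ _ ei ej card2.
have h2 := @ric_dot _ _ _ t A _ _ _ Nei ej card2.
move: h1 h2; rewrite d0 !mul0r dotNl !dot_e oppr_le0 => h1 h2.
have : (delta_mx j 0 - A^T *m (A *m (delta_mx j 0 : 'cV[R]_n))) i 0 = 0.
  by apply/eqP; rewrite eq_le h1 h2.
rewrite mulmxA -colE !mxE eqxx andbT eq_sym => /eqP; rewrite subr_eq0 => /eqP <-.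
by rewrite eq_sym.
Qed.

(** * Weights and blocks *)

Lemma top_subset (R : realType) (I : finType) (W : I -> R) (k : nat) (Q : {set I}) :
  (k <= #|Q|)%N ->
  exists T : {set I}, [/\ T \subset Q, #|T| = k &
    forall i j, i \in T -> j \in Q :\: T -> W j <= W i].
Proof.
elim: k => [|k IH] kQ.
  by exists finset.set0; rewrite finset.sub0set cards0; split=> // i j; rewrite inE.
have [T [TQ Tk TW]] := IH (ltnW kQ).
have /card_gt0P[i0 i0Q] : (0 < #|Q :\: T|)%N.
  by rewrite cardsD (finset.setIidPr TQ) Tk subn_gt0.
case: (@arg_maxP _ _ _ i0 (mem (Q :\: T)) W i0Q) => i /= iQ imax.
have /andP[iNT iinQ] : (i \notin T) && (i \in Q).
  by have : i \in Q :\: T := iQ; rewrite inE.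
exists (i |: T); split.
- by rewrite finset.subUset finset.sub1set iinQ.
- by rewrite cardsU1 iNT Tk.
move=> a b; rewrite !inE negb_or -andbA => aT /and3P[_ bNT bQ].
have bQT : b \in Q :\: T by rewrite inE bNT.
by case/predU1P: aT => [->|aT]; [exact: imax | exact: TW].
Qed.

Lemma restr_split (R : realType) (n : nat) (T Q : {set 'I_n}) (z : 'cV[R]_n) :
  T \subset Q -> restr T z + restr (Q :\: T) z = restr Q z.
Proof.
move=> /fintype.subsetP TQ; apply/matrixP => i j; rewrite ord1 !mxE inE.
by case: ifPn => [/TQ ->|_] /=; rewrite ?addr0 ?add0r.
Qed.

Lemma l2norm_restr_split (R : realType) (n : nat) (T Q : {set 'I_n}) (z : 'cV[R]_n) :
  T \subset Q ->
  l2norm (restr T z) ^+ 2 + l2norm (restr (Q :\: T) z) ^+ 2 = l2norm (restr Q z) ^+ 2.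
Proof.
move=> TQ; rewrite -(restr_split z TQ) !l2norm_dot dotDl !dotDr.
have orth : dot (restr T z) (restr (Q :\: T) z) = 0.
  rewrite /dot big1 // => i _; rewrite !mxE !inE.
  by case: (i \in T); rewrite ?mul0r ?mulr0.
by rewrite (dotC (restr (Q :\: T) z)) orth addr0 add0r.
Qed.

(* Cutting [Q] greedily into blocks of size [k] in decreasing order of the
   weights, the maximum on each block but the first is at most the average on
   the previous block. *)
Lemma weight_blocks (R : realType) (n k : nat) (W : 'I_n -> R) (Q : {set 'I_n})
    (M : R) :
  (0 < k)%N -> (forall j, 0 <= W j) -> 0 <= M -> (forall j, j \in Q -> W j <= M) ->
  exists s : seq (R * {set 'I_n}),
    [/\ forall b, b \in s -> [/\ (#|b.2| <= k)%N, b.2 \subset Q, 0 <= b.1 <= M &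
                             forall j, j \in b.2 -> W j <= b.1],
        forall z : 'cV[R]_n, \sum_(b <- s) restr b.2 z = restr Q z,
        forall z : 'cV[R]_n,
          \sum_(b <- s) l2norm (restr b.2 z) ^+ 2 = l2norm (restr Q z) ^+ 2 &
        \sum_(b <- s) b.1 <= M + (\sum_(j in Q) W j) / k%:R].
Proof.
move=> k0 W0; have [N] := ubnP #|Q|; elim: N => // N IH in Q M *.
rewrite ltnS => QN M0 WM.
have kR : 0 < (k%:R : R) by rewrite ltr0n.
have [Qk|kQ] := leqP #|Q| k.
  exists [:: (M, Q)]; split.
  - by move=> b; rewrite inE => /eqP -> /=; rewrite M0 lexx.
  - by move=> z; rewrite big_seq1.
  - by move=> z; rewrite big_seq1.
  by rewrite big_seq1 lerDl divr_ge0 ?ler0n // sumr_ge0.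
have [T [TQ Tk TW]] := top_subset W (ltnW kQ).
have /card_gt0P[i0 i0T] : (0 < #|T|)%N by rewrite Tk.
case: (@arg_minP _ _ _ i0 (mem T) W i0T) => i /= iT imin.
(* The least weight [W i] of the first block caps all remaining weights, so it replaces [M] in the
   recursive call. *)
have [|||s [sP sz sn ss]] := IH (Q :\: T) (W i).
- apply: leq_trans QN; rewrite cardsD (finset.setIidPr TQ) Tk.
  by rewrite ltn_subrL k0 (leq_trans _ kQ).
- exact: W0.
- by move=> j jQ; exact: TW.
have iM : W i <= M by apply: WM; apply: (fintype.subsetP TQ).
exists ((M, T) :: s); split.
- move=> b; rewrite inE => /predU1P[->|/sP[b1 b2 /andP[b3 b4] b5]] /=.
    by rewrite Tk M0 lexx; split=> // j jT; apply: WM; apply: (fintype.subsetP TQ).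
  split=> //; last by rewrite b3 (le_trans b4).
  exact: (fintype.subset_trans b2 (finset.subsetDl _ _)).
- by move=> z; rewrite big_cons sz restr_split.
- by move=> z; rewrite big_cons sn l2norm_restr_split.
rewrite big_cons /= lerD2l (le_trans ss) //.
rewrite [leRHS](_ : _ =
  (\sum_(j in T) W j + \sum_(j in Q :\: T) W j) / k%:R); last first.
  by rewrite (finset.big_setID T (A := Q)) /= (finset.setIidPr TQ).
rewrite mulrDl lerD2r ler_pdivlMr //.
rewrite mulr_natr -Tk -sumr_const; apply: ler_sum => j; exact: imin.
Qed.

(* [2 / s + s / 4 >= sqrt 2] by AM-GM, so the block bound [sqrt 2] is enough
   whatever the number of blocks. *)
Lemma sqrt2_le_xi (R : realType) (q : nat) : (2 <= q)%N -> Num.sqrt 2 <= xi R q.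
Proof.
move=> q2; rewrite /xi leqNgt q2 /=; case: ltnP => // _.
have q0 : 0 < (q%:R : R) by rewrite ltr0n (leq_trans _ q2).
have s0 : 0 < Num.sqrt (q%:R : R) by rewrite sqrtr_gt0.
set s := Num.sqrt _ in s0 *.
apply: ler_sqr_nneg.
  by rewrite addr_ge0 // divr_ge0 // ltW.
rewrite sqr_sqrtr //.
have -> : (2 / s + s / 4) ^+ 2 = 2 + (2 / s - s / 4) ^+ 2 :> R.
  by field; rewrite gt_eqF.
by rewrite lerDl sqr_ge0.
Qed.

(** In the middle range the claim reads [s ^+ 2 + 8 <= 8 * s] with [s ^+ 2 = q] between 2 and 8.
    This upper bound later yields [x * d2 <= 2 * d3] in the comparison of coefficients. *)
Lemma xi_le2 (R : realType) (q : nat) : xi R q <= 2.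
Proof.
have r2 : Num.sqrt 2 <= 2 :> R.
  by apply: ler_sqr_nneg => //; rewrite sqr_sqrtr //; lra.
rewrite /xi; case: (leqP q 1) => [_|q2]; first lra.
case: ltnP => // q8.
have q0 : 0 <= (q%:R : R) by [].
have ql : 2 <= (q%:R : R) by rewrite ler_nat.
have qu : (q%:R : R) <= 8 by rewrite ler_nat ltnW.
have := sqr_sqrtr q0; have := sqrtr_ge0 (q%:R : R).
move: (Num.sqrt _) => s s0 ss.
have s1 : 1 < s by nra.
have s3 : s < 3 by nra.
have -> : 2 / s + s / 4 = (8 + s ^+ 2) / (4 * s) by field; lra.
rewrite ler_pdivrMr; nra.
Qed.

(** Excludes the value [xi 1 = 1], which lies below the block constant [sqrt 2]. *)
Lemma sigma_ge2 (n k : nat) : (1 <= k)%N -> (3 * k < n)%N -> (2 <= sigma_nk n k)%N.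
Proof.
move=> k1 kn; rewrite /sigma_nk.
have k0 : 0 < (k%:R : rat) by rewrite ltr0n.
suff : 1 < Num.ceil ((n%:R - 2 * k%:R) / k%:R : rat) by case: (Num.ceil _) => [[|[]]|].
have : (3 * k%:R < n%:R :> rat) by rewrite -natrM ltr_nat.
move=> h; rewrite ceil_gt_int ltr_pdivlMr //.
by lra.
Qed.

(** * One iteration *)

Lemma gradient_step_error (R : realType) (m n : nat) (A : 'M[R]_(m, n))
    (z : 'cV[R]_n) (y nu : 'cV[R]_m) (alpha beta : R) (xprev xcur : 'cV[R]_n) :
  y = A *m z + nu ->
  gradient_step A y alpha beta xprev xcur - z =
    (1 - alpha + beta) *: (xcur - z)
    + alpha *: ((xcur - z) - A^T *m (A *m (xcur - z)))
    + - beta *: (xprev - z) + alpha *: (A^T *m nu).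
Proof.
move=> ->; rewrite /gradient_step !mulmxBr !mulmxDr.
move: (A^T *m (A *m xcur)) (A^T *m (A *m z)) (A^T *m nu) => P Q N.
by apply/matrixP => i j; rewrite !mxE; ring.
Qed.

(** The terms in [xcur - z] and [xprev - z] that come without [A] stay restricted to [T], so that
    their squares can be summed over disjoint blocks. Only the [I - A^T A] term calls for the
    isometry constant of the joint support. *)
Lemma gradient_step_restr (R : realType) (m n k t : nat) (A : 'M[R]_(m, n))
    (z : 'cV[R]_n) (y nu : 'cV[R]_m) (alpha beta : R) (xprev xcur : 'cV[R]_n)
    (T : {set 'I_n}) :
  y = A *m z + nu -> 0 <= alpha -> 0 <= beta ->
  (#|T| <= k)%N -> (#|T :|: (supp xcur :|: supp z)| <= t)%N ->
  l2norm (restr T (gradient_step A y alpha beta xprev xcur - z)) <=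
    `|1 - alpha + beta| * l2norm (restr T (xcur - z))
    + beta * l2norm (restr T (xprev - z))
    + alpha * (ric A t * l2norm (xcur - z) + Num.sqrt (1 + ric A k) * l2norm nu).
Proof.
move=> yE a0 b0 Tk Tt; rewrite (gradient_step_error _ _ _ _ yE).
have := l2norm_restr_residual A (suppB xcur z) Tt.
move: (xcur - z) (xprev - z) => d e h1; rewrite !restrD !restrZ.
have h2 := l2norm_restr_trmx A nu Tk.
apply: (le_trans (l2normD _ _)).
apply: (le_trans (lerD (le_trans (l2normD _ _)
  (lerD (l2normD _ _) (lexx _))) (lexx _))).
rewrite !l2normZ normrN (ger0_norm a0) (ger0_norm b0).
have := ler_wpM2l a0 h1; have := ler_wpM2l a0 h2; lra.
Qed.

Lemma weighted_blocks (R : realType) (n : nat) (Q : {set 'I_n}) (z : 'cV[R]_n)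
    (s : seq (R * {set 'I_n})) :
  (forall b, b \in s -> 0 <= b.1 <= 1) -> \sum_(b <- s) b.1 <= 2 ->
  \sum_(b <- s) l2norm (restr b.2 z) ^+ 2 = l2norm (restr Q z) ^+ 2 ->
  \sum_(b <- s) b.1 * l2norm (restr b.2 z) <= Num.sqrt 2 * l2norm z.
Proof.
move=> s01 s2 sz; apply: (le_trans (cauchy_schwarz_seq _ _ _)).
rewrite sz sqrtr_sqr ger0_norm ?l2norm_ge0 //.
apply: ler_pM; rewrite ?sqrtr_ge0 ?l2norm_ge0 ?l2norm_restr //.
apply: ler_wsqrtr; apply: le_trans s2; rewrite !big_seq; apply: ler_sum => b.
by move=> /s01/andP[b0 b1]; rewrite expr2 ler_piMr.
Qed.

(** The terms in [d] and [e] are square-summable over the blocks and cost [sqrt 2]. The constant [c]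
    is charged on every block and costs the sum of the block maxima, at most 2. *)
Lemma weighted_tail (R : realType) (m n k : nat) (A : 'M[R]_(m, n))
    (Q : {set 'I_n}) (W : 'I_n -> R) (v g d e : 'cV[R]_n) (a b c : R) :
  (0 < k)%N -> (forall i, 0 <= W i <= 1) -> \sum_i W i <= k%:R ->
  (forall i, i \in Q -> `|v i 0| <= W i * `|g i 0|) ->
  0 <= a -> 0 <= b -> 0 <= c ->
  (forall T : {set 'I_n}, (#|T| <= k)%N ->
     l2norm (restr T g) <= a * l2norm (restr T d) + b * l2norm (restr T e) + c) ->
  l2norm (A *m restr Q v) <= Num.sqrt (1 + ric A k) *
    (Num.sqrt 2 * (a * l2norm d + b * l2norm e) + 2 * c).
Proof.
move=> k0 W01 Wk vW a0 b0 c0 gT.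
have W0 j : 0 <= W j by have /andP[] := W01 j.
have W1 j : j \in Q -> W j <= 1 by move=> _; have /andP[] := W01 j.
have [s [sP sv sn ss]] := weight_blocks k0 W0 ler01 W1.
(* One for the cap on the first block, and one for the total weight, at most [k], divided by [k]. *)
have s2 : \sum_(b <- s) b.1 <= 2.
  apply: (le_trans ss); rewrite -[leRHS]/(1 + 1) lerD2l ler_pdivrMr ?ltr0n // mul1r.
  apply: le_trans Wk; rewrite [leRHS](bigID (mem Q)) /= lerDl.
  exact: sumr_ge0.
have s01 p : p \in s -> 0 <= p.1 <= 1 by move=> /sP[].
rewrite -sv mulmx_sumr; apply: (le_trans (l2norm_sum _ _)).
apply: (@le_trans _ _ (\sum_(p <- s) Num.sqrt (1 + ric A k) *
  (a * (p.1 * l2norm (restr p.2 d)) + b * (p.1 * l2norm (restr p.2 e)) + p.1 * c))).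
  rewrite !big_seq; apply: ler_sum => p ps.
  have [pk pQ /andP[p0 _] pW] := sP _ ps.
  have rv := ric_upper A (sparse_le (supp_restr p.2 v) pk).
  apply: (le_trans rv); apply: ler_wpM2l; first exact: sqrtr_ge0.
  apply: (@le_trans _ _ (p.1 * l2norm (restr p.2 g))); last first.
    by have := ler_wpM2l p0 (gT _ pk); lra.
  rewrite -[X in X * _](ger0_norm p0) -l2normZ; apply: l2norm_le => i.
  rewrite !mxE; case: ifPn => [ip|_]; last by rewrite mulr0.
  rewrite normrM (ger0_norm p0); apply: (le_trans (vW _ (fintype.subsetP pQ _ ip))).
  by apply: ler_wpM2r => //; exact: pW.
rewrite -mulr_sumr; apply: ler_wpM2l; first exact: sqrtr_ge0.
rewrite !big_split /= -!mulr_sumr -mulr_suml.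
have hd := weighted_blocks s01 s2 (sn d).
have he := weighted_blocks s01 s2 (sn e).
have := ler_wpM2l a0 hd; have := ler_wpM2l b0 he; have := ler_wpM2r c0 s2.
lra.
Qed.

(** The composed weights are products of factors in [0, 1], so their sum is at most that of the last
    factor. For [j = 0] the weights are all 1 and sum to [n], whence the guard [0 < j]. *)
Lemma hadamard_uptoP (R : realType) (n k : nat) (u : 'cV[R]_n)
    (w : nat -> 'cV[R]_n) (j : nat) :
  (forall i, (1 <= i <= j)%N -> in_polytope k (w i)) ->
  exists W : 'I_n -> R,
    [/\ forall i, 0 <= W i <= 1, (0 < j)%N -> \sum_i W i <= k%:R &
        forall i, hadamard_upto u w j i 0 = W i * u i 0].
Proof.
elim: j => [|j IH] wP.
  by exists (fun=> 1); split=> // i; rewrite ?ler01 ?lexx ?mul1r.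
have [|W [W01 Wk Wu]] := IH.
  by move=> i /andP[i1 ij]; apply: wP; rewrite i1 leqW.
have [wk w01] := wP j.+1 (leqnn _).
exists (fun i => W i * w j.+1 i 0); split.
- move=> i; have /andP[a0 a1] := W01 i; have /andP[b0 b1] := w01 i.
  by rewrite mulr_ge0 //= mulr_ile1.
- move=> _; rewrite -wk; apply: ler_sum => i _.
  have /andP[a0 a1] := W01 i; have /andP[b0 b1] := w01 i.
  by rewrite ler_piMl.
by move=> i; rewrite /= mxE Wu mulrAC.
Qed.

Lemma minimizer_le_restr (R : realType) (m n k : nat) (A : 'M[R]_(m, n))
    (y : 'cV[R]_m) (v w : 'cV[R]_n) (S : {set 'I_n}) :
  #|S| = k ->
  is_minimizer (@in_polytope R n k)
    (fun w' => l2norm (y - A *m hadamard v w') ^+ 2) w ->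
  l2norm (y - A *m hadamard v w) <= l2norm (y - A *m restr S v).
Proof.
move=> Sk [_ /(_ (\col_i (i \in S)%:R))].
have -> : hadamard v (\col_i (i \in S)%:R) = restr S v.
  by apply/matrixP => i j; rewrite ord1 !mxE; case: (i \in S); rewrite ?mulr1 ?mulr0.
move=> h; apply: ler_sqr_nneg; first exact: l2norm_ge0.
apply: h; split; last by move=> i; rewrite mxE; case: (i \in S); rewrite ?ler01 ?lexx.
rewrite -Sk -sum1_card natr_sum [RHS]big_mkcond /=; apply: eq_bigr => i _.
by rewrite mxE; case: (i \in S).
Qed.

(** The entries of [S] that are discarded are as many as the entries kept outside [S], and no larger
    than any of them. Their norm is therefore charged to the kept ones. *)
Lemma hard_thr_error (R : realType) (n k : nat) (L : 'cV[R]_n -> {set 'I_n})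
    (S : {set 'I_n}) (V z : 'cV[R]_n) :
  largest_selector k L -> #|S| = k -> supp z \subset S ->
  l2norm (hard_thr L V - z) <=
    l2norm (restr (S :|: L V) (V - z)) + l2norm (restr (L V :\: S) V).
Proof.
move=> Lk Sk zS; have [Xk XV] := Lk V; set X := L V in Xk XV *.
have cardD : #|S :\: X| = #|X :\: S|.
  by rewrite !cardsD Sk Xk finset.setIC.
have z0 i : i \notin S -> z i 0 = 0.
  by move=> /(contra (fintype.subsetP zS i)); rewrite inE negbK => /eqP.
have -> : hard_thr L V - z =
    restr (S :|: X) (V - z) + - restr (S :\: X) V.
  apply/matrixP => i j; rewrite ord1 /hard_thr -/X !mxE !inE.
  by case: (boolP (i \in S)) => [_|/z0 ->] /=; case: (i \in X) => /=; ring.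
apply: (le_trans (l2normD _ _)); rewrite lerD2l l2normN.
have [E0|] := posnP #|S :\: X|.
  rewrite [l2norm (restr (S :\: X) V)](_ : _ = 0) ?l2norm_ge0 //.
  have -> : S :\: X = finset.set0 by apply/eqP; rewrite -cards_eq0 E0.
  rewrite -[RHS](l2norm0 R n); congr l2norm.
  by apply/matrixP => i j; rewrite !mxE inE.
move=> /card_gt0P[i0 i0P].
(* The largest discarded entry separates the two sets, so both sums of squares are compared with the
   same multiple of its square. *)
case: (@arg_maxP _ _ _ i0 (mem (S :\: X)) (fun i => `|V i 0|) i0P) => i /= iP imax.
have iNX : i \notin X by have : i \in S :\: X := iP; rewrite inE => /andP[].
apply: ler_sqr_nneg; first exact: l2norm_ge0.
have restr_sum (Q : {set 'I_n}) :
    l2norm (restr Q V) ^+ 2 = \sum_(j in Q) `|V j 0| ^+ 2.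
  rewrite l2norm_sqr [RHS]big_mkcond; apply: eq_bigr => j _; rewrite mxE.
  by case: ifP; rewrite ?expr0n // real_normK ?num_real.
rewrite !restr_sum; apply: (@le_trans _ _ (\sum_(j in S :\: X) `|V i 0| ^+ 2)).
  by apply: ler_sum => j jP; rewrite ler_sqr ?nnegrE //; exact: imax.
rewrite sumr_const cardD -sumr_const; apply: ler_sum => j.
by rewrite inE => /andP[_ jX]; rewrite ler_sqr ?nnegrE //; exact: XV.
Qed.

(* The increment needs no [nu]-term: [|y - A v_S| <= |y - A v| + |A v_{S^c}|]. *)
Lemma rot_step_residual (R : realType) (m n k omega : nat) (A : 'M[R]_(m, n))
    (z : 'cV[R]_n) (y nu : 'cV[R]_m) (S : {set 'I_n}) (u : 'cV[R]_n)
    (w : nat -> 'cV[R]_n) (B : R) :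
  y = A *m z + nu -> supp z \subset S -> #|S| = k ->
  (forall j, (1 <= j <= omega)%N ->
     is_minimizer (@in_polytope R n k)
       (fun w' => l2norm (y - A *m hadamard (hadamard_upto u w j.-1) w') ^+ 2)
       (w j)) ->
  (forall j, (1 <= j <= omega)%N ->
     l2norm (A *m restr (~: S) (hadamard_upto u w j)) <= B) ->
  forall j, (1 <= j <= omega)%N ->
    l2norm (y - A *m hadamard_upto u w j) <=
    l2norm nu + Num.sqrt (1 + ric A k) * l2norm (restr S (u - z)) + (j%:R - 1) * B.
Proof.
move=> yE zS Sk wP tailB; elim=> // -[|j] IH jo.
  rewrite subrr mul0r addr0.
  apply: (le_trans (minimizer_le_restr Sk (wP 1%N jo))) => /=.
  (* The first round starts from [u] itself, whose tail carries no weights, so the residual is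
     compared directly with [nu]. *)
  have -> : y - A *m restr S u = nu - A *m restr S (u - z).
    rewrite restrD restrN (restr_id zS) mulmxBr yE.
    by apply/matrixP => a b; rewrite !mxE; ring.
  apply: (le_trans (l2normD _ _)); rewrite l2normN lerD2l.
  by apply: ric_upper; apply: sparse_le (supp_restr _ _) _; rewrite Sk.
have jo' : (1 <= j.+1 <= omega)%N by exact: ltnW.
apply: (le_trans (minimizer_le_restr Sk (wP j.+2 jo))); rewrite [j.+2.-1]/=.
set v := hadamard_upto u w j.+1.
have -> : y - A *m restr S v = (y - A *m v) + A *m restr (~: S) v.
  by rewrite -{2}(restr_setC S v) mulmxDr; apply/matrixP => a b; rewrite !mxE; ring.
apply: (le_trans (l2normD _ _)).
have := IH jo'; have := tailB _ jo'; rewrite -/v -[j.+2%:R]natr1.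
move: (j.+1%:R : R) => x; lra.
Qed.

(** The error on [S :|: L V] is read off its image under [A] through the lower isometry bound; the
    part kept outside [S] is bounded entrywise. The tail bound [B] is paid [omega] times:
    [omega - 1] times in the residual and once off [S :|: L V]. *)
Lemma rot_step_bound (R : realType) (m n k omega : nat) (A : 'M[R]_(m, n))
    (z : 'cV[R]_n) (y nu : 'cV[R]_m) (S : {set 'I_n})
    (L : 'cV[R]_n -> {set 'I_n}) (alpha beta : R) (xprev xcur xsharp : 'cV[R]_n) :
  (1 <= k)%N -> (1 <= omega)%N -> largest_selector k L ->
  y = A *m z + nu -> supp z \subset S -> #|S| = k ->
  0 <= alpha -> 0 <= beta -> ric A (2 * k) < 1 -> sparse k xcur ->
  let w : R := omega%:R in
  let a : R := `|1 - alpha + beta| in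
  let sk : R := Num.sqrt (1 + ric A k) in
  let s2k : R := Num.sqrt (1 - ric A (2 * k)) in
  let tk : R := sk / s2k in
  rot_step A y k omega L alpha beta xprev xcur xsharp ->
  l2norm (xsharp - z) <=
    (tk * ((w * Num.sqrt 2 + 1) * a + alpha * (2 * w * ric A (3 * k) + ric A (2 * k)))
       + a + alpha * ric A (3 * k)) * l2norm (xcur - z)
    + beta * (tk * (w * Num.sqrt 2 + 1) + 1) * l2norm (xprev - z)
    + ((2 + alpha * (2 * w + 1) * (1 + ric A k)) / s2k + alpha * sk) * l2norm nu.
Proof.
move=> k1 o1 Lk yE zS Sk a0 b0 d21 xk om a sk s2k tk [w [wP ->]].
set u := gradient_step A y alpha beta xprev xcur in wP *.
set D := l2norm (xcur - z); set E := l2norm (xprev - z); set N := l2norm nu.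
set d2 := ric A (2 * k) in d21 s2k tk *; set d3 := ric A (3 * k).
have an0 : 0 <= a by exact: normr_ge0.
have sk0 : 0 <= sk by exact: sqrtr_ge0.
have skk : sk ^+ 2 = 1 + ric A k by rewrite sqr_sqrtr // addr_ge0 ?ric_ge0.
have s2k0 : 0 < s2k by rewrite sqrtr_gt0 subr_gt0.
have suppk : (#|supp xcur :|: S| <= 2 * k)%N.
  rewrite mul2n -addnn -{2}Sk; apply: (leq_trans (leq_card_setU _ _)).
  by rewrite leq_add2r.
have suppz : supp xcur :|: supp z \subset supp xcur :|: S by rewrite finset.setUS.
have gT (T : {set 'I_n}) : (#|T| <= k)%N ->
    l2norm (restr T (u - z)) <= a * l2norm (restr T (xcur - z))
      + beta * l2norm (restr T (xprev - z)) + alpha * (d3 * D + sk * N).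
  move=> Tk; apply: gradient_step_restr => //.
  apply: (leq_trans (leq_card_setU _ _)).
  rewrite mulSn leq_add // (leq_trans _ suppk) //; exact: subset_leq_card.
(* On [S] itself at most [2 * k] indices are involved, which gives [d2] instead of [d3]. *)
have gS : l2norm (restr S (u - z)) <= a * D + beta * E + alpha * (d2 * D + sk * N).
  have St : (#|S :|: (supp xcur :|: supp z)| <= 2 * k)%N.
    apply: leq_trans suppk; apply: subset_leq_card.
    by rewrite finset.subUset finset.subsetUr suppz.
  have Sk' : (#|S| <= k)%N by rewrite Sk.
  apply: (le_trans (gradient_step_restr xprev yE a0 b0 Sk' St)).
  rewrite lerD2r.
  exact: lerD (ler_wpM2l an0 (l2norm_restr _ _)) (ler_wpM2l b0 (l2norm_restr _ _)).
clearbody u.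
have z0 i : i \notin S -> z i 0 = 0.
  by move=> /(contra (fintype.subsetP zS i)); rewrite inE negbK => /eqP.
pose B := sk * (Num.sqrt 2 * (a * D + beta * E) + 2 * (alpha * (d3 * D + sk * N))).
have polyW j : (1 <= j <= omega)%N -> exists W : 'I_n -> R,
    [/\ forall i, 0 <= W i <= 1, \sum_i W i <= k%:R &
        forall i, hadamard_upto u w j i 0 = W i * u i 0].
  move=> /andP[j1 jo]; have [|W [W01 Wk Wu]] := @hadamard_uptoP R n k u w j.
    by move=> i /andP[i1 ij]; have [] := wP i; rewrite ?i1 ?(leq_trans ij).
  by exists W; split=> //; exact: Wk.
(* Any set disjoint from [S] is allowed, because the tail is needed off [S] for the residual and off
   [S :|: X] at the end. Off [S] the target [z] vanishes, so the iterate is a weight times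
   [u - z]. *)
have tail (Q : {set 'I_n}) j : S \subset ~: Q -> (1 <= j <= omega)%N ->
    l2norm (A *m restr Q (hadamard_upto u w j)) <= B.
  move=> /fintype.subsetP SQ /polyW[W [W01 Wk Wu]].
  have c0 : 0 <= alpha * (d3 * D + sk * N).
    by rewrite mulr_ge0 // addr_ge0 // mulr_ge0 ?ric_ge0 ?l2norm_ge0.
  apply: (@weighted_tail _ _ _ k A Q W _ (u - z) (xcur - z) (xprev - z)) => //.
  move=> i iQ; have iS : i \notin S by apply/negP => /SQ; rewrite inE iQ.
  have /andP[W0 _] := W01 i.
  by rewrite Wu mxE [(- z) i 0]mxE (z0 _ iS) subr0 normrM (ger0_norm W0).
have oo : (1 <= omega <= omega)%N by rewrite o1 leqnn.
have res : l2norm (y - A *m hadamard_upto u w omega) <=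
    N + sk * l2norm (restr S (u - z)) + (om - 1) * B.
  apply: (rot_step_residual yE zS Sk wP _ oo) => i io.
  by apply: tail io; rewrite finset.setCK.
set V := hadamard_upto u w omega in res *.
apply: (le_trans (hard_thr_error V Lk Sk zS)).
have [Xk _] := Lk V; set X := L V in Xk *.
have inner : l2norm (restr (S :|: X) (V - z)) <=
    s2k^-1 * (N + (N + sk * l2norm (restr S (u - z)) + (om - 1) * B) + B).
  rewrite mulrC ler_pdivlMr // mulrC.
  have Uk : (#|S :|: X| <= 2 * k)%N.
    by rewrite mul2n -addnn -{1}Sk -Xk leq_card_setU.
  have lo := ric_lower (ltW d21) (sparse_le (supp_restr (S :|: X) (V - z)) Uk).
  apply: (le_trans lo).
  have zU : supp z \subset S :|: X := fintype.subset_trans zS (finset.subsetUl _ _).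
  (* Noise, residual and tail. The noise occurs here and again in the residual bound, whence the 2
     in the final coefficient of [nu]. *)
  have -> : A *m restr (S :|: X) (V - z) =
      nu + - (y - A *m V) + - (A *m restr (~: (S :|: X)) V).
    rewrite restrD restrN (restr_id zU) mulmxBr yE -{2}(restr_setC (S :|: X) V).
    by rewrite mulmxDr; apply/matrixP => c e; rewrite !mxE; ring.
  apply: (le_trans (l2normD _ _)); rewrite [l2norm (- (A *m _))]l2normN.
  apply: lerD; last by apply: tail => //; rewrite finset.setCK finset.subsetUl.
  by apply: (le_trans (l2normD _ _)); rewrite l2normN lerD2l.
(* The weights only shrink [u - z] outside [S], so this part enters without the factor [tk]. *)
have outer : l2norm (restr (X :\: S) V) <=
    a * D + beta * E + alpha * (d3 * D + sk * N).
  have XSk : (#|X :\: S| <= k)%N by rewrite -Xk subset_leq_card // finset.subsetDl.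
  apply: (@le_trans _ _ (l2norm (restr (X :\: S) (u - z)))).
    have [W [W01 _ Wu]] := polyW _ oo.
    apply: l2norm_le => i; rewrite !mxE; case: ifPn => //.
    rewrite inE => /andP[iS _]; have /andP[W0 W1] := W01 i.
    by rewrite Wu (z0 _ iS) subr0 normrM (ger0_norm W0) ler_piMl.
  apply: (le_trans (gT _ XSk)); rewrite lerD2r.
  exact: lerD (ler_wpM2l an0 (l2norm_restr _ _)) (ler_wpM2l b0 (l2norm_restr _ _)).
apply: (le_trans (lerD inner outer)).
have h := ler_wpM2l sk0 gS; have si : 0 <= s2k^-1 by rewrite invr_ge0 ltW.
have := ler_wpM2l si h.
rewrite /tk /B -skk; set r := Num.sqrt 2; set q := s2k^-1.
move: (l2norm (restr S (u - z))) => G1; nra.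
Qed.


(** * The least squares step *)

Lemma least_squares_orth (R : realType) (m n : nat) (A : 'M[R]_(m, n))
    (x' g : 'cV[R]_n) (y : 'cV[R]_m) (T : {set 'I_n}) :
  is_minimizer (fun v : 'cV[R]_n => supp v \subset T)
    (fun v => l2norm (y - A *m v) ^+ 2) x' ->
  supp g \subset T -> dot (A *m g) (y - A *m x') = 0.
Proof.
move=> [x'T x'min] gT; set p := dot _ _; pose q := l2norm (A *m g) ^+ 2.
have q0 : 0 <= q by exact: sqr_ge0.
(* Variation of the minimizer along [g] with step [p / (q + 1)]: close to the optimal [p / q], yet
   defined when [A *m g] is 0. The change of the objective is [- (q + 2)] times the squared step,
   which forces [p = 0]. *)
have : 0 <= - 2 * (p / (q + 1)) * p + (p / (q + 1)) ^+ 2 * q.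
  have := x'min (x' + (p / (q + 1)) *: g); move: (p / (q + 1)) => t h.
  have : supp (x' + t *: g) \subset T.
    apply: (fintype.subset_trans (suppD _ _)); rewrite finset.subUset x'T.
    exact: fintype.subset_trans (suppZ _ _) gT.
  move=> /h; rewrite mulmxDr -scalemxAr opprD addrA.
  rewrite (l2normB_sqr (y - A *m x')) dotZr (dotC _ (A *m g)) -/p l2normZ exprMn.
  by rewrite real_normK ?num_real // -/q; nra.
have -> : - 2 * (p / (q + 1)) * p + (p / (q + 1)) ^+ 2 * q
    = - ((q + 2) * (p / (q + 1)) ^+ 2) by field; lra.
rewrite oppr_ge0 pmulr_rle0; last lra.
rewrite le_eqVlt ltNge sqr_ge0 orbF sqrf_eq0 mulf_eq0 invr_eq0.
by case/orP => /eqP // h; have : False by lra.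
Qed.

(** By contraposition: if [H] exceeds [B + F], with [B] and [F] the two summands on the right, then
    [(H - F) * H] exceeds [B ^+ 2], and the factored difference of the two sides of the hypothesis
    is positive. *)
Lemma quadratic_bound (R : realType) (d H f b : R) :
  0 <= d -> d < 1 -> 0 <= f -> 0 <= b -> H ^+ 2 <= (d * H + f) ^+ 2 + b ^+ 2 ->
  H <= b / Num.sqrt (1 - d ^+ 2) + f / (1 - d).
Proof.
move=> d0 d1 f0 b0.
have z0 : 0 < 1 - d ^+ 2 by nra.
have s0 : 0 < Num.sqrt (1 - d ^+ 2) by rewrite sqrtr_gt0.
have := sqr_sqrtr (ltW z0); move: (Num.sqrt _) s0 => s s0 ss.
have dp : 0 < 1 - d by rewrite subr_gt0.
apply: contra_leP => lt.
pose B := b / s; pose F := f / (1 - d).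
have bE : b = s * B by rewrite /B mulrCA divff ?mulr1 // gt_eqF.
have fE : f = (1 - d) * F by rewrite /F mulrCA divff ?mulr1 // gt_eqF.
have B0 : 0 <= B by rewrite divr_ge0 // ltW.
have F0 : 0 <= F by rewrite divr_ge0 // ltW.
rewrite -/B -/F in lt.
rewrite bE exprMn ss fE -subr_gt0.
have -> : H ^+ 2 - ((d * H + (1 - d) * F) ^+ 2 + (1 - d ^+ 2) * B ^+ 2) =
    (1 - d) * ((H - F) * ((1 + d) * H + (1 - d) * F) - (1 + d) * B ^+ 2) by ring.
apply: mulr_gt0 => //.
have BH : B < H - F by lra.
have HB : B < H by lra.
rewrite subr_gt0; apply: (@lt_le_trans _ _ ((1 + d) * ((H - F) * H))).
  have BB : B * B < (H - F) * H by exact: ltr_pM.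
  have d1' : 0 < 1 + d by lra.
  by rewrite ltr_pM2l // expr2.
rewrite mulrCA ler_wpM2l //; first by lra.
by rewrite lerDl mulr_ge0 // ltW.
Qed.

(** Off [T] the error [h] equals [- z]. On [T], orthogonality turns [dot (A *m g) (A *m h)] into
    [dot (A *m g) nu], so [ric_dot] bounds the norm of [g] by [d] times that of [h] plus noise.
    Pythagoras then gives the inequality solved by [quadratic_bound]. *)
Lemma least_squares_error (R : realType) (m n k : nat) (A : 'M[R]_(m, n))
    (z x' : 'cV[R]_n) (y nu : 'cV[R]_m) (S T : {set 'I_n}) :
  y = A *m z + nu -> supp z \subset S -> (#|S| <= k)%N -> (#|T| <= k)%N ->
  ric A (2 * k) < 1 ->
  is_minimizer (fun v : 'cV[R]_n => supp v \subset T)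
    (fun v => l2norm (y - A *m v) ^+ 2) x' ->
  l2norm (x' - z) <= l2norm (restr (~: T) z) / Num.sqrt (1 - ric A (2 * k) ^+ 2)
    + Num.sqrt (1 + ric A k) / (1 - ric A (2 * k)) * l2norm nu.
Proof.
move=> yE zS Sk Tk d1 x'min; have x'T := x'min.1.
pose h := x' - z; pose g := restr T h; rewrite -/h.
have gT : supp g \subset T by exact: supp_restr.
have hTS : supp h \subset T :|: S.
  by apply: (fintype.subset_trans (suppB _ _)); exact: finset.setUSS.
have TSk : (#|T :|: S| <= 2 * k)%N.
  by rewrite mul2n -addnn (leq_trans (leq_card_setU _ _)) // leq_add.
have gTS : supp g \subset T :|: S := fintype.subset_trans gT (finset.subsetUl _ _).
have orth := least_squares_orth x'min gT.
have res : y - A *m x' = nu - A *m h.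
  by rewrite yE /h mulmxBr; apply/matrixP => i j; rewrite !mxE; ring.
have AgAh : dot (A *m g) (A *m h) = dot (A *m g) nu.
  by move: orth; rewrite res dotDr dotNr => /eqP; rewrite subr_eq0 => /eqP.
have gh := ric_dot A gTS hTS TSk.
have Ag := ric_upper A (sparse_le gT Tk).
have split_h := l2norm_restr_split h (finset.subsetT T).
have restrT : restr [set: 'I_n] h = h by apply: restr_id; exact: finset.subsetT.
have tailz : l2norm (restr ([set: 'I_n] :\: T) h) = l2norm (restr (~: T) z).
  rewrite finset.setTD -(l2normN (restr _ z)); congr l2norm.
  apply/matrixP => i j; rewrite ord1 !mxE inE.
  case: ifPn => iT; last by rewrite oppr0.
  have /eqP -> : x' i 0 == 0.
    by apply: contraNT iT => xi; apply: (fintype.subsetP x'T); rewrite inE.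
  by rewrite add0r.
rewrite restrT tailz -/g in split_h.
set d := ric A (2 * k) in d1 gh *; set e := Num.sqrt (1 + ric A k) in Ag *.
have d0 : 0 <= d by exact: ric_ge0.
have e0 : 0 <= e by exact: sqrtr_ge0.
have g_le : l2norm g <= d * l2norm h + e * l2norm nu.
  have := dot_le (A *m g) nu.
  have : dot g h = l2norm g ^+ 2 by rewrite /g -dot_restr -l2norm_dot.
  move: gh; rewrite dotDr dotNr dot_trmx AgAh.
  have := l2norm_ge0 g; have := l2norm_ge0 h; have := l2norm_ge0 nu.
  have [-> _ h0 _ _ _ _|g0] := eqVneq (l2norm g) 0.
    by rewrite addr_ge0 ?mulr_ge0 ?l2norm_ge0.
  move=> nu0 h0; rewrite le0r (negPf g0) /= => gp h1 h2 h3.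
  rewrite -(ler_pM2l gp) -expr2 -h2.
  have := ler_wpM2r nu0 Ag; lra.
have := l2norm_ge0 g; have := l2norm_ge0 h; have := l2norm_ge0 (restr (~: T) z).
have := l2norm_ge0 nu.
move: split_h g_le; rewrite mulrAC.
move: (l2norm g) (l2norm h) (l2norm (restr (~: T) z)) (l2norm nu) => G H b N.
move=> GH g_le N0 b0 H0 G0.
have eN0 : 0 <= e * N by rewrite mulr_ge0.
move: (e * N) eN0 g_le => f f0 g_le.
apply: quadratic_bound => //; rewrite -GH lerD2r ler_sqr // nnegrE.
by rewrite addr_ge0 // mulr_ge0.
Qed.

(** * The scalar coefficients *)

(** Since [b2 = theta * (theta - b1)], the combination [a p.+1 + (theta - b1) * a p] obeys a
    one-step recurrence with factor [theta] and increment [c], whose fixed point is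
    [c / (1 - theta)]. *)
Lemma two_step_recurrence (R : realType) (a : nat -> R) (b1 b2 c theta : R) :
  theta < 1 -> 0 <= theta -> b1 <= theta -> theta * (theta - b1) = b2 ->
  (forall p, 0 <= a p) ->
  (forall p, (1 <= p)%N -> a p.+1 <= b1 * a p + b2 * a p.-1 + c) ->
  0 <= c ->
  forall p, (1 <= p)%N ->
    a p <= theta ^+ (p - 1) * (a 1%N + (theta - b1) * a 0%N) + c / (1 - theta).
Proof.
move=> t1 t0 tb tE a0 rec c0.
have key p : a p.+1 + (theta - b1) * a p <=
    theta ^+ p * (a 1%N + (theta - b1) * a 0%N) + c / (1 - theta).
  elim: p => [|p IH]; first by rewrite expr0 mul1r lerDl divr_ge0 // subr_ge0 ltW.
  have h := rec p.+1 isT; have h2 := ler_wpM2l t0 IH.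
  have cE : c / (1 - theta) = theta * (c / (1 - theta)) + c.
    by field; rewrite subr_eq0 gt_eqF.
  rewrite -tE /= in h; rewrite exprS [in leRHS]cE.
  lra.
case=> // p _; rewrite subn1 /=; apply: le_trans (key p).
by rewrite lerDl mulr_ge0 // subr_ge0.
Qed.

Lemma two_step_root (R : realType) (b1 b2 : R) :
  0 <= b1 -> 0 <= b2 -> b1 + b2 < 1 ->
  let theta := (b1 + Num.sqrt (b1 ^+ 2 + 4 * b2)) / 2 in
  [/\ theta < 1, 0 <= theta, b1 <= theta & theta * (theta - b1) = b2].
Proof.
move=> b10 b20 b12 theta.
have D0 : 0 <= b1 ^+ 2 + 4 * b2 by rewrite addr_ge0 ?sqr_ge0 // mulr_ge0.
have s0 := sqrtr_ge0 (b1 ^+ 2 + 4 * b2); have ss := sqr_sqrtr D0.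
have b1s : b1 <= Num.sqrt (b1 ^+ 2 + 4 * b2).
  by apply: ler_sqr_nneg => //; rewrite ss lerDl mulr_ge0.
have s2 : Num.sqrt (b1 ^+ 2 + 4 * b2) < 2 - b1.
  rewrite ltNge; apply/negP => h.
  have : (2 - b1) ^+ 2 <= b1 ^+ 2 + 4 * b2.
    by rewrite -ss ler_sqr ?nnegrE //; lra.
  move=> h2; lra.
rewrite /theta; move: (Num.sqrt _) s0 ss b1s s2 => s s0 ss b1s s2.
by split; lra.
Qed.

(** Reduces the rate of HBROTP to [two_step_root] with coefficients [b1 / z] and [b2 / z]. *)
Lemma two_step_root_scaled (R : realType) (b1 b2 z : R) :
  0 < z -> 0 <= b1 ^+ 2 + 4 * b2 * z ->
  (b1 + Num.sqrt (b1 ^+ 2 + 4 * b2 * z)) / (2 * z) =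
  (b1 / z + Num.sqrt ((b1 / z) ^+ 2 + 4 * (b2 / z))) / 2.
Proof.
move=> z0 D0.
have -> : (b1 / z) ^+ 2 + 4 * (b2 / z) = (b1 ^+ 2 + 4 * b2 * z) * (z^-1) ^+ 2.
  by field; rewrite gt_eqF.
rewrite sqrtrM // sqrtr_sqr ger0_norm ?invr_ge0 1?ltW //.
by field; rewrite gt_eqF.
Qed.

(* The coefficients of [rot_step_bound] are smaller than [b_2] and [b_3]; the
   latter contain the mediants [c / c1] and [c / (c - c1)], which are compared
   through [x d2 <= 2 d3]. *)
Lemma coef_momentum (R : realType) (w x d2 d3 alpha a : R) :
  1 <= w -> 0 < x -> x <= 2 -> 0 < d2 -> d2 <= d3 -> 0 < alpha -> 0 <= a ->
  let D1 := 2 * (w - 1) * d3 + d2 in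
  let D := 2 * w * d3 + d2 in
  let p1 := x * (w - 1) + 1 in
  let c1 := p1 * a + alpha * D1 in
  let c := (w * x + 1) * a + alpha * D in
  w * x + 1 <= p1 * (c / c1) /\ p1 * (c / c1) <= p1 * (D / D1).
Proof.
move=> w1 x0 x2 d20 d23 al a0 D1 D p1 c1 c.
have xd : x * d2 <= 2 * d3 by nra.
have D10 : 0 < D1 by rewrite /D1 ltr_wpDl // mulr_ge0 ?mulr_ge0 //; lra.
have p10 : 0 < p1 by rewrite /p1 ltr_wpDl // mulr_ge0 //; lra.
have c10 : 0 < c1 by rewrite /c1 ltr_wpDl ?mulr_gt0 // mulr_ge0 // ltW.
(* The two sides differ by exactly [2 * d3 - x * d2]. *)
have key : (w * x + 1) * D1 <= p1 * D by rewrite /D1 /p1 /D; lra.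
split.
  rewrite mulrA ler_pdivlMr // /c1 /c.
  have := ler_wpM2l (ltW al) key; lra.
apply: ler_wpM2l; first exact: ltW.
rewrite ler_pdivrMr // mulrAC ler_pdivlMr // /c1 /c.
have := ler_wpM2r a0 key; lra.
Qed.

Lemma coef_noise (R : realType) (w x d2 d3 alpha a K : R) :
  1 <= w -> 0 < x -> x <= 2 -> 0 < d2 -> d2 <= d3 -> 0 < alpha -> 0 <= a ->
  let D1 := 2 * (w - 1) * d3 + d2 in
  let c1 := (x * (w - 1) + 1) * a + alpha * D1 in
  let c := (w * x + 1) * a + alpha * (2 * w * d3 + d2) in
  0 <= K ->
  2 + alpha * (2 * w + 1) * K <=
  (alpha * (2 * w - 1) * K + 2) * (2 * d3 / D1) * (c / (c - c1)).
Proof.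
move=> w1 x0 x2 d20 d23 al a0 D1 c1 c K0.
have d30 : 0 < d3 by lra.
have xd : x * d2 <= 2 * d3 by nra.
have D10 : 0 < D1 by rewrite /D1 ltr_wpDl // mulr_ge0 ?mulr_ge0 //; lra.
have cc : c - c1 = x * a + 2 * (alpha * d3) by rewrite /c /c1 /D1; ring.
have cc0 : 0 < c - c1.
  by rewrite cc ltr_wpDl ?mulr_gt0 // mulr_ge0 // ltW.
pose D := D1 + 2 * d3.
(* [D / D1] eliminates [a]: what remains to be compared afterwards reduces to [d2 <= d3]. *)
have h1 : D / D1 <= (2 * d3 / D1) * (c / (c - c1)).
  rewrite [leRHS]mulrACA -invfM ler_pdivlMr ?mulr_gt0 // mulrA divfK ?gt_eqF //.
  rewrite cc /c /D /D1.
  have e1 : 0 <= a * (2 * d3 - x * d2) by rewrite mulr_ge0 // subr_ge0.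
  nra.
have n0 : 0 <= alpha * (2 * w - 1) * K + 2.
  by rewrite addr_ge0 // !mulr_ge0 //; lra.
rewrite -[leRHS]mulrA; apply: le_trans (ler_wpM2l n0 h1).
rewrite mulrA ler_pdivlMr // /D /D1.
have e2 : 0 <= alpha * K * (d3 - d2) by rewrite !mulr_ge0 ?subr_ge0 // ltW.
nra.
Qed.

(** The lower bound on [alpha] is the claim for [1 - alpha + beta] nonnegative, the upper bound the
    claim for it negative. [zeta] is 1 for HBROT and [z_k] for HBROTP. *)
Lemma contraction_condition (R : realType) (d0 d1 d2 alpha beta zeta : R) :
  0 < d0 -> 0 <= d1 -> d1 < zeta -> zeta <= 1 -> 0 <= d2 -> 0 <= beta ->
  ((d0 + d2 + 2) * beta + d0 + 1 - zeta) / (d0 - d1 + 1) < alpha ->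
  alpha < (d0 + 1 + zeta - (d2 - d0) * beta) / (d0 + d1 + 1) ->
  0 < alpha /\
  `|1 - alpha + beta| * (d0 + 1) + alpha * d1 + beta * (d2 + 1) < zeta.
Proof.
move=> d00 d10 d1z z1 d20 b0.
have e0 : 0 < d0 - d1 + 1 by lra.
have f0 : 0 < d0 + d1 + 1 by lra.
move=> h1 h2; have al : 0 < alpha.
  apply: le_lt_trans h1; apply: divr_ge0; last exact: ltW.
  have : 0 <= (d0 + d2 + 2) * beta by rewrite mulr_ge0 //; lra.
  lra.
split=> //.
move: h1 h2; rewrite ltr_pdivrMr // ltr_pdivlMr // => h1 h2.
by case: (ger0P (1 - alpha + beta)) => _; lra.
Qed.

(** * Existence and uniqueness of the threshold roots *)

Lemma G_lt (R : realType) (omega : nat) (g h : R) :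
  0 <= g -> g < h -> h < 1 -> G omega g < G omega h.
Proof.
move=> g0 gh h1; rewrite /G; apply: ler_ltD => //.
have w0 : 0 <= 2 * omega%:R + 1 :> R by rewrite addr_ge0 ?mulr_ge0.
apply: ler_pM; rewrite ?sqrtr_ge0 ?mulr_ge0 //.
  by rewrite ler_wpM2l // ltW.
apply: ler_wsqrtr; rewrite ler_pdivrMr; last lra.
rewrite mulrAC ler_pdivlMr; lra.
Qed.

Lemma G_root_unique (R : realType) (omega : nat) (g h : R) :
  0 < g < 1 -> 0 < h < 1 -> G omega g = 1 -> G omega h = 1 -> g = h.
Proof.
move=> /andP[g0 g1] /andP[h0 h1] Gg Gh.
case: (ltgtP g h) => // lt.
  by have := G_lt omega (ltW g0) lt h1; rewrite Gg Gh ltxx.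
by have := G_lt omega (ltW h0) lt g1; rewrite Gg Gh ltxx.
Qed.

(** A root is a crossing of the increasing [G omega] with the decreasing [sqrt (1 - g ^+ 2)]. *)
Lemma G_root_scaled_unique (R : realType) (omega : nat) (g h : R) :
  0 < g < 1 -> 0 < h < 1 ->
  1 / Num.sqrt (1 - g ^+ 2) * G omega g = 1 ->
  1 / Num.sqrt (1 - h ^+ 2) * G omega h = 1 -> g = h.
Proof.
have pos (a : R) : 0 < a < 1 -> 0 < Num.sqrt (1 - a ^+ 2).
  by move=> /andP[a0 a1]; rewrite sqrtr_gt0 subr_gt0 expr_lt1 // ltW.
have toE (a : R) : 0 < a < 1 -> 1 / Num.sqrt (1 - a ^+ 2) * G omega a = 1 ->
    G omega a = Num.sqrt (1 - a ^+ 2).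
  move=> /pos s0; rewrite mul1r mulrC => /(canRL (mulfVK _)) -> //.
    by rewrite mul1r.
  by rewrite gt_eqF.
have mono (a b : R) : 0 < a -> a < b -> b < 1 ->
    Num.sqrt (1 - b ^+ 2) <= Num.sqrt (1 - a ^+ 2).
  move=> a0 ab b1; apply: ler_wsqrtr; rewrite lerD2l lerN2 ler_sqr ?nnegrE ltW //.
  exact: lt_trans ab.
move=> gP hP /(toE _ gP) Gg /(toE _ hP) Gh.
have /andP[g0 g1] := gP; have /andP[h0 h1] := hP.
case: (ltgtP g h) => // lt.
  have := G_lt omega (ltW g0) lt h1; rewrite Gg Gh ltNge.
  by rewrite mono.
have := G_lt omega (ltW h0) lt g1; rewrite Gg Gh ltNge.
by rewrite mono.
Qed.

(* Clearing the square root, [G omega g = 1] becomes the cubic equation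
   [((2 omega + 1) g) ^ 2 (1 + g) = (1 - g) ^ 3]. *)
Lemma G_root_exists (R : realType) (omega : nat) :
  exists2 g : R, 0 < g < 1 & G omega g = 1.
Proof.
pose c : R := 2 * omega%:R + 1.
have c1 : 1 <= c by rewrite lerDr mulr_ge0.
pose P : {poly R} := (c *: 'X) ^+ 2 * (1 + 'X) - (1 - 'X) ^+ 3.
have PE g : P.[g] = (c * g) ^+ 2 * (1 + g) - (1 - g) ^+ 3 by rewrite /P !hornerE.
have [||g /andP[g0 g1] /rootP] := @poly_ivt R P 0 1.
- exact: ler01.
- by rewrite !PE; apply/andP; split; nra.
rewrite PE => gE.
have gn0 : g != 0 by apply/eqP => g0'; move: gE; rewrite g0'; lra.
have gn1 : g != 1.
  by apply/eqP => g1'; move: gE; rewrite g1'; nra.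
have gp : 0 < g by rewrite lt_def gn0.
have gl : g < 1 by rewrite lt_neqAle gn1.
exists g; first by rewrite gp.
rewrite /G -/c.
have cg0 : 0 <= c * g by rewrite mulr_ge0 //; lra.
have -> : c * g * Num.sqrt ((1 + g) / (1 - g)) = 1 - g; last lra.
rewrite -[X in X * _](ger0_norm cg0) -sqrtr_sqr -sqrtrM ?sqr_ge0 //.
have -> : (c * g) ^+ 2 * ((1 + g) / (1 - g)) = (1 - g) ^+ 2.
  have -> : (c * g) ^+ 2 * ((1 + g) / (1 - g)) = ((c * g) ^+ 2 * (1 + g)) / (1 - g).
    by rewrite mulrA.
  move/eqP: gE; rewrite subr_eq0 => /eqP ->; field; lra.
by rewrite sqrtr_sqr ger0_norm // subr_ge0 ltW.
Qed.

(* As in [G_root_exists], but the cubic obtained by squaring has the right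
   sign only on [0, 1 / (2 omega + 2)]. *)
Lemma G_root_scaled_exists (R : realType) (omega : nat) :
  exists2 g : R, 0 < g < 1 & 1 / Num.sqrt (1 - g ^+ 2) * G omega g = 1.
Proof.
pose c : R := 2 * omega%:R + 1.
have c1 : 1 <= c by rewrite lerDr mulr_ge0.
(* With [s] the root of [1 - g ^+ 2], the equation is [g * s = (1 + g) * (1 - (c + 1) * g)]; [P] is
   the difference of the squares divided by [1 + g]. *)
pose P : {poly R} := 'X ^+ 2 * (1 - 'X) - (1 - (c + 1) *: 'X) ^+ 2 * (1 + 'X).
have PE g : P.[g] = g ^+ 2 * (1 - g) - (1 - (c + 1) * g) ^+ 2 * (1 + g).
  by rewrite /P !hornerE.
have c0 : 0 < c + 1 by lra.
have v0 : 0 < (c + 1)^-1 by rewrite invr_gt0.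
have cv : (c + 1) * (c + 1)^-1 = 1 by rewrite divff // gt_eqF.
have v1 : (c + 1)^-1 < 1 by rewrite invf_lt1 //; lra.
have [||g /andP[g0 gv] /rootP] := @poly_ivt R P 0 (c + 1)^-1.
- exact: ltW.
- rewrite !PE; apply/andP; split; first lra.
  by rewrite cv subrr expr0n /= mul0r subr0 mulr_ge0 ?sqr_ge0 // subr_ge0 ltW.
rewrite PE => gE.
have gn0 : g != 0 by apply/eqP => g0'; move: gE; rewrite g0'; lra.
have gp : 0 < g by rewrite lt_def gn0.
have gl : g < 1 by apply: le_lt_trans v1.
have cg : (c + 1) * g <= 1 by rewrite -[leRHS]cv ler_wpM2l // ltW.
exists g; first by rewrite gp.
rewrite /G -/c.
have z0 : 0 < 1 - g ^+ 2 by rewrite subr_gt0 expr_lt1.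
have s0 : 0 < Num.sqrt (1 - g ^+ 2) by rewrite sqrtr_gt0.
have ss := sqr_sqrtr (ltW z0).
have -> : Num.sqrt ((1 + g) / (1 - g)) = (1 + g) / Num.sqrt (1 - g ^+ 2).
  have -> : (1 + g) / (1 - g) = (1 + g) ^+ 2 / (1 - g ^+ 2) by field; lra.
  rewrite sqrtrM ?sqr_ge0 // sqrtrV ?ltW // sqrtr_sqr ger0_norm //.
  by rewrite addr_ge0 // ltW.
move: (Num.sqrt _) s0 ss => s s0 ss.
have gs : g * s = (1 + g) * (1 - (c + 1) * g).
  apply/eqP; rewrite -(@eqrXn2 _ 2) //; last first.
  - by rewrite mulr_ge0 //; lra.
  - by rewrite mulr_ge0 // ltW.
  rewrite !exprMn ss; apply/eqP; apply/eqP; rewrite -subr_eq0.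
  have -> : g ^+ 2 * (1 - g ^+ 2) - (1 + g) ^+ 2 * (1 - (c + 1) * g) ^+ 2 =
     (1 + g) * (g ^+ 2 * (1 - g) - (1 - (c + 1) * g) ^+ 2 * (1 + g)) by ring.
  by rewrite gE mulr0.
have -> : 1 / s * (c * g * ((1 + g) / s) + g) = (c * g * (1 + g) + g * s) / s ^+ 2.
  by field; rewrite gt_eqF.
have -> : c * g * (1 + g) + g * s = s ^+ 2 by rewrite gs ss; ring.
by rewrite divff // sqrf_eq0 gt_eqF.
Qed.

(** * Convergence *)

(** Common core of both algorithms: the step bound in terms of the stated coefficients, and the
    estimate of [b1 + b2] that [contraction_condition] controls. *)
Lemma rot_step_contract (R : realType) (m n k omega : nat)
    (A : 'M[R]_(m, n)) (x : 'cV[R]_n) (y nu : 'cV[R]_m)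
    (L : 'cV[R]_n -> {set 'I_n}) (alpha beta : R) :
  let w : R := omega%:R in
  let xis : R := xi R (sigma_nk n k) in
  let xS := restr (L x) x in
  let nu' := nu + A *m restr (~: L x) x in
  let dk := ric A k in
  let d2k := ric A (2 * k) in
  let d3k := ric A (3 * k) in
  let tk := Num.sqrt (1 + dk) / Num.sqrt (1 - d2k) in
  let d0 := tk * (w * xis + 1) in
  let d1 := tk * (2 * w * d3k + d2k) + d3k in
  let d2 := tk * (xis * (w - 1) + 1) *
            ((2 * w * d3k + d2k) / (2 * (w - 1) * d3k + d2k)) in
  let c1s := (xis * (w - 1) + 1) * `|1 - alpha + beta|
             + alpha * (2 * (w - 1) * d3k + d2k) in
  let cs := (w * xis + 1) * `|1 - alpha + beta|
            + alpha * (2 * w * d3k + d2k) in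
  let b1 := tk * cs + `|1 + beta - alpha| + alpha * d3k in
  let b2 := beta * tk * (xis * (w - 1) + 1) * (cs / c1s) + beta in
  let b3 := (alpha * (2 * w - 1) * (1 + dk) + 2) / Num.sqrt (1 - d2k)
            * (2 * d3k / (2 * (w - 1) * d3k + d2k))
            * (cs / (cs - c1s))
            + alpha * Num.sqrt (1 + dk) in
  (m < n)%N -> (1 <= k)%N -> (1 <= omega)%N -> (3 * k < n)%N ->
  largest_selector k L -> y = A *m x + nu ->
  0 < alpha -> 0 <= beta -> d3k < 1 ->
  [/\ 0 <= b1, 0 <= b2, 0 <= b3,
      b1 + b2 <= `|1 - alpha + beta| * (d0 + 1) + alpha * d1 + beta * (d2 + 1) &
      forall xprev xcur xsharp, sparse k xcur ->
        rot_step A y k omega L alpha beta xprev xcur xsharp ->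
        l2norm (xsharp - xS) <= b1 * l2norm (xcur - xS)
          + b2 * l2norm (xprev - xS) + b3 * l2norm nu'].
Proof.
move=> w xis xS nu' dk d2k d3k tk d0 d1 d2 c1s cs b1 b2 b3.
move=> mn k1 o1 kn Lk yE al be d31.
have w1 : 1 <= w by rewrite ler1n.
have sig := sigma_ge2 k1 kn.
have r0 : 0 < Num.sqrt 2 :> R by rewrite sqrtr_gt0.
have rx : Num.sqrt 2 <= xis := sqrt2_le_xi R sig.
have x0 : 0 < xis := lt_le_trans r0 rx.
have x2 : xis <= 2 := xi_le2 R _.
have dk0 : 0 <= dk := ric_ge0 k A.
have d20 : 0 < d2k by apply: ric_gt0 => //; rewrite leq_pmulr.
have d23 : d2k <= d3k by apply: ric_le; rewrite leq_mul2r orbT.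
have d21 : d2k < 1 := le_lt_trans d23 d31.
have s2k0 : 0 < Num.sqrt (1 - d2k) by rewrite sqrtr_gt0 subr_gt0.
have sk0 : 0 <= Num.sqrt (1 + dk) := sqrtr_ge0 _.
have tk0 : 0 <= tk by rewrite divr_ge0 // ltW.
have si : 0 <= (Num.sqrt (1 - d2k))^-1 by rewrite invr_ge0 ltW.
have a0 : 0 <= `|1 - alpha + beta| := normr_ge0 _.
have K0 : 0 <= 1 + dk by rewrite addr_ge0.
have [mom1 mom2] := coef_momentum w1 x0 x2 d20 d23 al a0.
have noise := coef_noise w1 x0 x2 d20 d23 al a0 K0.
rewrite -/c1s -/cs in mom1 mom2; rewrite -/c1s -/cs in noise.
have aE : `|1 + beta - alpha| = `|1 - alpha + beta| by rewrite addrAC.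
have wx : w * Num.sqrt 2 + 1 <= w * xis + 1 by rewrite lerD2r ler_wpM2l //; lra.
(* The primed coefficients are those of [rot_step_bound], with [sqrt 2] where the stated ones have
   [xi]. *)
pose b1' := tk * ((w * Num.sqrt 2 + 1) * `|1 - alpha + beta|
  + alpha * (2 * w * d3k + d2k)) + `|1 - alpha + beta| + alpha * d3k.
pose b2' := beta * (tk * (w * Num.sqrt 2 + 1) + 1).
pose b3' := (2 + alpha * (2 * w + 1) * (1 + dk)) / Num.sqrt (1 - d2k)
  + alpha * Num.sqrt (1 + dk).
have al0 := ltW al.
have d30 : 0 <= d3k := ric_ge0 _ A.
have w0 : 0 <= w * Num.sqrt 2 + 1 by rewrite addr_ge0 // mulr_ge0 // ltW.
have D0 : 0 <= 2 * w * d3k + d2k by rewrite addr_ge0 ?mulr_ge0 // ltW.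
have b1'0 : 0 <= b1'.
  apply: addr_ge0; last exact: mulr_ge0.
  by apply: addr_ge0 => //; apply: mulr_ge0 => //; apply: addr_ge0; exact: mulr_ge0.
have b2'0 : 0 <= b2'.
  by apply: mulr_ge0 => //; apply: addr_ge0 => //; exact: mulr_ge0.
have b3'0 : 0 <= b3'.
  apply: addr_ge0; last exact: mulr_ge0.
  apply: divr_ge0; last exact: ltW.
  apply: addr_ge0 => //; apply: mulr_ge0 => //; apply: mulr_ge0 => //.
  by apply: addr_ge0 => //; exact: mulr_ge0.
have b1_le : b1' <= b1.
  rewrite /b1 /b1' aE; do 2 apply: lerD => //.
  by apply: ler_wpM2l => //; apply: lerD => //; exact: ler_wpM2r.
have b2_le : b2' <= b2.
  rewrite /b2 /b2' mulrDr mulr1 -!mulrA; apply: lerD => //.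
  by do 3 apply: ler_wpM2l => //; exact: le_trans wx mom1.
have b3_le : b3' <= b3.
  apply: lerD => //; apply: (le_trans (ler_wpM2r si noise)).
  lra.
split; try exact: le_trans b1_le; try exact: le_trans b2_le; try exact: le_trans b3_le.
  (* [b1] matches the first two summands exactly; only [b2] is estimated, by replacing [cs / c1s]
     with the larger ratio in [d2]. *)
  have b1E : b1 = `|1 - alpha + beta| * (d0 + 1) + alpha * d1.
    by rewrite /b1 aE /cs /d0 /d1; ring.
  have b2E : b2 = beta * (tk * ((xis * (w - 1) + 1) * (cs / c1s))) + beta.
    by rewrite /b2; ring.
  rewrite b1E b2E lerD2l [leRHS]mulrDr mulr1; apply: lerD => //; apply: ler_wpM2l => //.
  by rewrite /d2 -[leRHS]mulrA; exact: ler_wpM2l.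
have Sk : #|L x| = k := (Lk x).1.
have yE' : y = A *m xS + nu'.
  by rewrite yE -{1}(restr_setC (L x) x) mulmxDr -addrA [_ + nu]addrC.
move=> xprev xcur xsharp xk step.
have := rot_step_bound k1 o1 Lk yE' (supp_restr _ _) Sk (ltW al) be d21 xk step.
move/le_trans; apply; rewrite -/w -/dk -/d2k -/d3k -/tk -/b1' -/b2' -/b3'.
by rewrite !lerD // ler_wpM2r // l2norm_ge0.
Qed.

Lemma sparse_rot_step (R : realType) (m n k omega : nat) (A : 'M[R]_(m, n))
    (y : 'cV[R]_m) (L : 'cV[R]_n -> {set 'I_n}) (alpha beta : R)
    (xprev xcur xsharp : 'cV[R]_n) :
  largest_selector k L ->
  rot_step A y k omega L alpha beta xprev xcur xsharp -> sparse k xsharp.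
Proof.
move=> Lk [w [_ ->]]; apply: sparse_le (supp_restr _ _) _.
by rewrite (Lk _).1.
Qed.

Theorem theorem2 (R : realType) (m n k omega : nat)
    (A : 'M[R]_(m, n)) (x : 'cV[R]_n) (y nu : 'cV[R]_m)
    (L : 'cV[R]_n -> {set 'I_n}) (alpha beta : R) :
  (m < n)%N -> (1 <= k)%N -> (1 <= omega)%N -> (3 * k < n)%N ->
  largest_selector k L ->
  y = A *m x + nu ->
  0 <= alpha -> 0 <= beta ->
  let w : R := omega%:R in
  let xis : R := xi R (sigma_nk n k) in
  let S := L x in
  let xS := restr S x in
  let nu' := nu + A *m restr (~: S) x in
  let dk := ric A k in
  let d2k := ric A (2 * k) in
  let d3k := ric A (3 * k) in
  let tk := Num.sqrt (1 + dk) / Num.sqrt (1 - d2k) in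
  let zk := Num.sqrt (1 - d2k ^+ 2) in
  let d0 := tk * (w * xis + 1) in
  let d1 := tk * (2 * w * d3k + d2k) + d3k in
  let d2 := tk * (xis * (w - 1) + 1) *
            ((2 * w * d3k + d2k) / (2 * (w - 1) * d3k + d2k)) in
  let c1s := (xis * (w - 1) + 1) * `|1 - alpha + beta|
             + alpha * (2 * (w - 1) * d3k + d2k) in
  let cs := (w * xis + 1) * `|1 - alpha + beta|
            + alpha * (2 * w * d3k + d2k) in
  let b1 := tk * cs + `|1 + beta - alpha| + alpha * d3k in
  let b2 := beta * tk * (xis * (w - 1) + 1) * (cs / c1s) + beta in
  let b3 := (alpha * (2 * w - 1) * (1 + dk) + 2) / Num.sqrt (1 - d2k)
            * (2 * d3k / (2 * (w - 1) * d3k + d2k))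
            * (cs / (cs - c1s))
            + alpha * Num.sqrt (1 + dk) in
  let root1 := fun g : R => 0 < g < 1 /\ G omega g = 1 in
  let root2 := fun g : R =>
    0 < g < 1 /\ 1 / Num.sqrt (1 - g ^+ 2) * G omega g = 1 in
  ((exists! g : R, root1 g) /\
   forall gstar : R, root1 gstar ->
     d3k < gstar ->
     beta < (1 - d1) / (1 + d1 + d2) ->
     ((d0 + d2 + 2) * beta + d0) / (d0 - d1 + 1) < alpha ->
     alpha < (d0 + 2 - (d2 - d0) * beta) / (d0 + d1 + 1) ->
     let theta1 := (b1 + Num.sqrt (b1 ^+ 2 + 4 * b2)) / 2 in
     theta1 < 1 /\
     forall xs : nat -> 'cV[R]_n,
       HBROT A y k omega L alpha beta xs ->
       sparse k (xs 0%N) -> sparse k (xs 1%N) ->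
       forall p : nat, (1 <= p)%N ->
         l2norm (xs p - xS) <=
         theta1 ^+ (p - 1)
           * (l2norm (xs 1%N - xS) + (theta1 - b1) * l2norm (xs 0%N - xS))
         + b3 / (1 - theta1) * l2norm nu')
  /\
  ((exists! g : R, root2 g) /\
   forall gsharp : R, root2 gsharp ->
     d3k < gsharp ->
     beta < (zk - d1) / (1 + d1 + d2) ->
     ((d0 + d2 + 2) * beta + d0 + 1 - zk) / (d0 - d1 + 1) < alpha ->
     alpha < (d0 + 1 + zk - (d2 - d0) * beta) / (d0 + d1 + 1) ->
     let theta2 := (b1 + Num.sqrt (b1 ^+ 2 + 4 * b2 * zk)) / (2 * zk) in
     theta2 < 1 /\
     forall xs : nat -> 'cV[R]_n,
       HBROTP A y k omega L alpha beta xs ->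
       sparse k (xs 0%N) -> sparse k (xs 1%N) ->
       forall p : nat, (1 <= p)%N ->
         l2norm (xs p - xS) <=
         theta2 ^+ (p - 1)
           * (l2norm (xs 1%N - xS) + (theta2 - b1 / zk) * l2norm (xs 0%N - xS))
         + 1 / (1 - theta2)
           * (b3 / zk + Num.sqrt (1 + dk) / (1 - d2k)) * l2norm nu').

Proof.
move=> mn k1 o1 kn Lk yE al0 be w xis S xS nu' dk d2k d3k tk zk d0 d1 d2.
move=> c1s cs b1 b2 b3 root1 root2.
have dk0 : 0 <= dk := ric_ge0 k A.
have d20 : 0 <= d2k := ric_ge0 _ A.
have d30 : 0 <= d3k := ric_ge0 _ A.
have d23 : d2k <= d3k by apply: ric_le; rewrite leq_mul2r orbT.
have w1 : 1 <= w by rewrite ler1n.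
have x0 : 0 <= xis.
  exact: le_trans (sqrtr_ge0 _) (sqrt2_le_xi R (sigma_ge2 k1 kn)).
have params : d3k < 1 -> [/\ 0 < d0, 0 <= d1 & 0 <= d2].
  move=> d31; have d21 := le_lt_trans d23 d31.
  have sk0 : 0 < Num.sqrt (1 + dk) by rewrite sqrtr_gt0 ltr_wpDr.
  have s2k0 : 0 < Num.sqrt (1 - d2k) by rewrite sqrtr_gt0 subr_gt0.
  have tk0 : 0 < tk by exact: divr_gt0.
  have p0 : 0 <= xis * (w - 1) + 1 by rewrite addr_ge0 ?mulr_ge0 // subr_ge0.
  have D0 : 0 <= 2 * w * d3k + d2k by rewrite addr_ge0 ?mulr_ge0 //; lra.
  have D10 : 0 <= 2 * (w - 1) * d3k + d2k by rewrite addr_ge0 ?mulr_ge0 //; lra.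
  split; rewrite /d0 /d1 /d2.
  - by rewrite mulr_gt0 // ltr_wpDl // mulr_ge0 //; lra.
  - by rewrite addr_ge0 // mulr_ge0 // ltW.
  - by rewrite !mulr_ge0 ?invr_ge0 // ltW.
have S_sparse (xs : nat -> 'cV[R]_n) p :
    sparse k (xs 0%N) -> sparse k (xs 1%N) ->
    (forall q, (1 <= q)%N -> sparse k (xs q.+1)) -> sparse k (xs p).
  by move=> s0 s1 sS; case: p => [|[|p]] //; exact: sS.
split; split.
- have [g gP gE] := G_root_exists R omega.
  by exists g; split=> // h [hP hE]; exact: (G_root_unique (omega := omega)).
- move=> g [/andP[_ g1] _] dg hb hlo hup theta.
  have d31 := lt_trans dg g1.
  have [d00 d10 d2_0] := params d31.
  have e0 : 0 < 1 + d1 + d2 by lra.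
  (* A nonnegative [beta] below the quotient makes its numerator positive. *)
  have d11 : d1 < 1.
    have := le_lt_trans be hb; rewrite pmulr_lgt0 ?invr_gt0 // subr_gt0 //.
  have [al sum_lt] : 0 < alpha /\
      `|1 - alpha + beta| * (d0 + 1) + alpha * d1 + beta * (d2 + 1) < 1.
    apply: (@contraction_condition _ d0 d1 d2 alpha beta 1) => //.
    - by rewrite addrK.
    - by rewrite (_ : d0 + 1 + 1 = d0 + 2) //; ring.
  have [b10 b20 b30 sum_le step] :=
    rot_step_contract mn k1 o1 kn Lk yE al be d31.
  have [t1 t0 tb tE] := two_step_root b10 b20 (le_lt_trans sum_le sum_lt).
  split=> // xs hx s0 s1 p p1.
  have sp q : sparse k (xs q).
    by apply: S_sparse => // r r1; exact: sparse_rot_step Lk (hx r r1).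
  rewrite mulrAC.
  apply: (@two_step_recurrence _ (fun q => l2norm (xs q - xS)) b1 b2) => //.
  + by move=> q; exact: l2norm_ge0.
  + by move=> q q1; exact: step (sp q) (hx q q1).
  + by rewrite mulr_ge0 // l2norm_ge0.
- have [g gP gE] := G_root_scaled_exists R omega.
  by exists g; split=> // h [hP hE]; exact: (G_root_scaled_unique (omega := omega)).
move=> g [/andP[_ g1] _] dg hb hlo hup theta.
have d31 := lt_trans dg g1.
have d21 := le_lt_trans d23 d31.
have [d00 d10 d2_0] := params d31.
have e0 : 0 < 1 + d1 + d2 by lra.
have d1z : d1 < zk.
  have := le_lt_trans be hb; rewrite pmulr_lgt0 ?invr_gt0 // subr_gt0 //.
have z0 : 0 < zk := le_lt_trans d10 d1z.
have z1 : zk <= 1.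
  by rewrite -sqrtr1; apply: ler_wsqrtr; rewrite lerBlDr lerDl sqr_ge0.
have [al sum_lt] := contraction_condition d00 d10 d1z z1 d2_0 be hlo hup.
have [b10 b20 b30 sum_le step] :=
  rot_step_contract mn k1 o1 kn Lk yE al be d31.
have D0 : 0 <= b1 ^+ 2 + 4 * b2 * zk.
  by rewrite addr_ge0 ?sqr_ge0 // !mulr_ge0 // ltW.
have thetaE : theta = (b1 / zk + Num.sqrt ((b1 / zk) ^+ 2 + 4 * (b2 / zk))) / 2.
  exact: two_step_root_scaled.
have b1z : 0 <= b1 / zk by rewrite divr_ge0 // ltW.
have b2z : 0 <= b2 / zk by rewrite divr_ge0 // ltW.
have sum_z : b1 / zk + b2 / zk < 1.
  by rewrite -mulrDl ltr_pdivrMr // mul1r (le_lt_trans sum_le).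
have := two_step_root b1z b2z sum_z; cbv zeta; rewrite -thetaE => -[t1 t0 tb tE].
split=> // xs hx s0 s1 p p1.
have sp q : sparse k (xs q).
  apply: S_sparse => // r r1; have [xsharp hstep [hsub _]] := hx r r1.
  by apply: sparse_le hsub _; exact: sparse_rot_step Lk hstep.
pose c : R := (b3 / zk + Num.sqrt (1 + dk) / (1 - d2k)) * l2norm nu'.
have c0 : 0 <= c.
  rewrite mulr_ge0 ?l2norm_ge0 // addr_ge0 ?divr_ge0 ?sqrtr_ge0 ?(ltW z0) //.
  by rewrite subr_ge0 ltW.
have -> : 1 / (1 - theta) * (b3 / zk + Num.sqrt (1 + dk) / (1 - d2k)) * l2norm nu'
    = c / (1 - theta) by rewrite /c; ring.
apply: (@two_step_recurrence _ (fun q => l2norm (xs q - xS)) (b1 / zk) (b2 / zk)) => //.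
  by move=> q; exact: l2norm_ge0.
move=> q q1; have [xsharp hstep hmin] := hx q q1.
have yE' : y = A *m xS + nu'.
  by rewrite yE -{1}(restr_setC (L x) x) mulmxDr -addrA [_ + nu]addrC.
have Sk : (#|S| <= k)%N by rewrite (Lk x).1.
have := least_squares_error yE' (supp_restr _ _) Sk (sparse_rot_step Lk hstep) d21 hmin.
move/le_trans; apply.
(* Off its own support [xsharp] vanishes, so there [xS] coincides with [xS - xsharp], and the
   thresholding error bounds what least squares cannot recover. *)
have tail : l2norm (restr (~: supp xsharp) xS) <= l2norm (xsharp - xS).
  rewrite l2normBC; apply: (le_trans _ (l2norm_restr (~: supp xsharp) _)).
  rewrite restrD restrN [X in _ - X](_ : _ = 0) ?subr0 //.
  apply/matrixP => i j; rewrite ord1 !mxE !inE negbK.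
  by case: eqP.
have zi : 0 <= zk^-1 by rewrite invr_ge0 ltW.
have hstep' : l2norm (restr (~: supp xsharp) xS) / zk <=
    (b1 * l2norm (xs q - xS) + b2 * l2norm (xs q.-1 - xS) + b3 * l2norm nu') / zk :=
  ler_wpM2r zi (le_trans tail (step _ _ _ (sp q) hstep)).
apply: (le_trans (lerD hstep' (lexx _))); rewrite -/d2k -/dk -/zk le_eqVlt.
by apply/orP; left; apply/eqP; rewrite /c; ring.
Qed.
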